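(* Let $\mathcal O$ be a linear relatively pseudo-cellular DG-operad of length $\alpha$ over a commutative ring $\Bbbk$, with underlying graded operad $\mathcal O_0\amalg\mathcal F(V)$, $V=\bigoplus_{\beta<\alpha}V_\beta$, and with differential on generators $d=(d^0,d^1)\colon V\to\mathcal O_0\oplus\langle V\rangle_{\mathcal O_0}$. Then the canonical strong pseudo-cylinder $I\mathcal O$ has underlying graded operad $\mathcal O_0\amalg\mathcal F(IV)$, and its differential is defined on the free part by the following formulas, for $x\in V$: $$d\,i_0(x)=i_0d(x),\qquad d\,i_1(x)=i_1d(x),\qquad d(\sigma x)=i_0(x)-i_1(x)-\sigma d^1(x).$$
   Context: Conventions. $\Bbbk$ is a commutative ring; graded modules are $\mathbb Z$-graded $\Bbbk$-modules, differentials have degree $-1$, and tensor products use the Koszul sign rule. The suspension $\Sigma X$ of a chain complex has $(\Sigma X)_n=X_{n-1}$, $d_{\Sigma X}=-d_X$, and $\sigma\colon X\to\Sigma X$ is the degree $+1$ map which is the identity degreewise. A ''sequence'' is a family indexed by arity $n\geq 0$; constructions and maps on sequences are aritywise. Operads. All operads are non-symmetric, with arities $n\ge 0$. A graded operad $\mathcal O=\{\mathcal O(n)\}_{n\geq0}$ has compositions $\circ_i\colon\mathcal O(p)\otimes\mathcal O(q)\to\mathcal O(p+q-1)$, $1\le i\le p$, and $\mathrm{id}\in\mathcal O(1)_0$, with (laws) $x\circ_i(y\circ_jz)=(x\circ_iy)\circ_{i+j-1}z$; $(x\circ_iy)\circ_jz=(-1)^{|y||z|}(x\circ_jz)\circ_{i+n-1}y$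 for $j<i$, $z\in\mathcal O(n)$; $\mathrm{id}\circ_1x=x=x\circ_i\mathrm{id}$. A DG-operad moreover has a differential with $d(x\circ_iy)=d(x)\circ_iy+(-1)^{|x|}x\circ_id(y)$. Strong pseudo-cylinders. A strong pseudo-cylinder $(C,i_0,i_1,p,h)$ of a chain complex $X$ consists of chain maps $i_0,i_1\colon X\to C$, $p\colon C\to X$ and a degree $+1$ map $h\colon C\to C$ with $i_0p-1_C=dh+hd$, $pi_0=pi_1=1_X$, $ph=0$, $hi_0=0$, $h^2=0$. The canonical one is $IX=X\oplus\Sigma X\oplus X$, where $i_0,i_1$ are the inclusions of the first and third summands, $d(\sigma x)=i_0x-i_1x-\sigma d(x)$, $p(i_0x)=p(i_1x)=x$, $p(\sigma x)=0$, with homotopy $h_I(i_1x)=\sigma x$, $h_I(i_0x)=h_I(\sigma x)=0$. A strong pseudo-cylinder of a DG-operad $\mathcal O$ is a DG-operad $\mathcal P$ with DG-operad maps $i_0,i_1\colon\mathcal O\to\mathcal P$, $p\colon\mathcal P\to\mathcal O$ and a sequence of degree $+1$ maps $h_{\mathcal O}\colon\mathcal P\to\mathcal P$ which aritywise form a strong pseudo-cylinder of chain complexes. Trees and coproducts. A tree is a planted planar tree with leaves; its inner vertices (those other than the bottom vertex of the root edge and the top vertices of the leaves) are ordered by the path order: $v\le w$ if the path from the root to $v$ is contained in the path to $w$ or branches off to the left of it. Levels count distance from the bottom of the root edge, so the bottommost inner vertex has level $1$; a leaf has the level of its top vertex. The arity $\tilde v$ of an inner vertex $v$ is the number of edges adjacent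 from above. $\mathcal F(V)$ is the free operad on a sequence $V$. The coproduct of operads decomposes as $(\mathcal O\amalg\mathcal F(V))(n)=\bigoplus_T(\mathcal O,V)(T)$, over trees $T$ with $n$ leaves, all of even level, where $(\mathcal O,V)(T)$ is the tensor product, in the path order, of $\mathcal O(\tilde u)$ for $u$ inner of odd level and $V(\tilde v)$ for $v$ inner of even level; a tensor (labeled tree) corresponds to the iterated composition of its labels nested according to $T$ and written in the path order. If $(\mathcal P,i_0,i_1,p,h_{\mathcal O})$ is a strong pseudo-cylinder of $\mathcal O$, then $h_{\mathcal O,V}$ is the degree $+1$ self-map of $\mathcal P\amalg\mathcal F(IV)$ preserving each summand $(\mathcal P,IV)(T)$ and given there, on a tensor $y_1\otimes\cdots\otimes y_m$ of labels in path order, by $\sum_{k=1}^m(-1)^{|y_1|+\cdots+|y_{k-1}|}i_0p(y_1)\otimes\cdots\otimes i_0p(y_{k-1})\otimes h(y_k)\otimes y_{k+1}\otimes\cdots\otimes y_m$, where $h$ is $h_{\mathcal O}$ on labels in $\mathcal P$ and $h_I$ on labels in $IV$. Twisted coproducts and induced cylinders. For a degree $-1$ map of sequences $\partial\colon V\to\mathcal O$ with $\partial d_V+d_{\mathcal O}\partial=0$, the twisted coproduct $\mathcal O\amalg_\partial\mathcal F(V)$ is $\mathcal O\amalg\mathcal F(V)$ as a graded operad, with differential extending $d_{\mathcal O}$ and equal to $d_V+\partial$ on $V$. The extension of $\partial$ to $\mathcal O\amalg\mathcal F(V)$ is the unique degree $-1$ self-map vanishing on $\mathcal O$, equal to $\partial$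 on $V$, and satisfying the operadic Leibniz rule. Given a strong pseudo-cylinder $(\mathcal P,i_0,i_1,p,h_{\mathcal O})$ of $\mathcal O$, the canonical induced strong pseudo-cylinder of $\mathcal O\amalg_\partial\mathcal F(V)$ is $\mathcal P\amalg_{\partial_I}\mathcal F(IV)$ with $\partial_I(i_0x)=i_0\partial(x)$, $\partial_I(\sigma x)=-h_{\mathcal O}i_1\partial(x)$, $\partial_I(i_1x)=i_1\partial(x)$ for $x\in V$, structure maps $i_0\amalg\mathcal F(i_0)$, $i_1\amalg\mathcal F(i_1)$, $p\amalg\mathcal F(p)$, and homotopy $h_\partial=\sum_{n\ge0}(h_{\mathcal O,V}\partial_I)^nh_{\mathcal O,V}$ (a locally finite sum, with $\partial_I$ extended to $\mathcal P\amalg\mathcal F(IV)$). Relatively pseudo-cellular DG-operads. $\mathcal O$ is relatively pseudo-cellular of length an ordinal $\alpha$ if it has an increasing filtration $\{\mathcal O_\beta\}_{\beta\le\alpha}$ by DG-operads with $\mathcal O_\alpha=\mathcal O$, $\mathcal O_\beta=\mathrm{colim}_{\gamma<\beta}\mathcal O_\gamma$ for limit $\beta\le\alpha$, and $\mathcal O_{\beta+1}=\mathcal O_\beta\amalg_{\partial_\beta}\mathcal F(V_\beta)$ (for some sequence of chain complexes $V_\beta$ and some $\partial_\beta$) whenever $\beta+1\le\alpha$. As a graded operad $\mathcal O=\mathcal O_0\amalg\mathcal F(V)$ with $V=\bigoplus_{\beta<\alpha}V_\beta$. Its canonical strong pseudo-cylinder $(I\mathcal O,i_0,i_1,p,h_{\mathcal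 O})$ is defined by induction on $\alpha$: for $\alpha=0$ it is the trivial one ($I\mathcal O=\mathcal O$, $i_0=i_1=p=1$, $h_{\mathcal O}=0$); for limit $\alpha$ it is the colimit of those of $\mathcal O_\beta$, $\beta<\alpha$; for $\alpha=\beta+1$ it is the canonical induced strong pseudo-cylinder of $\mathcal O_\beta\amalg_{\partial_\beta}\mathcal F(V_\beta)$ obtained from that of $\mathcal O_\beta$. Modules and linearity. For a graded operad $\mathcal Q$, a $\mathcal Q$-module is a sequence $M$ of graded modules with compositions $\circ_i\colon M(p)\otimes\mathcal Q(q)\to M(p+q-1)$ and $\circ_i\colon\mathcal Q(p)\otimes M(q)\to M(p+q-1)$ satisfying the operad laws above when one variable is in $M$ and the others in $\mathcal Q$. The suspension $\Sigma M$ is a $\mathcal Q$-module via $(\sigma x)\circ_iy=\sigma(x\circ_iy)$, $y\circ_i(\sigma x)=(-1)^{|y|}\sigma(y\circ_ix)$. For $\mathcal O$ relatively pseudo-cellular, $\langle V\rangle_{\mathcal O_0}\subset\mathcal O$ is the sub-$\mathcal O_0$-module spanned by $V$ (it is free on $V$, consisting of the summands of $\mathcal O_0\amalg\mathcal F(V)$ indexed by trees with exactly one inner vertex of even level), and $\mathcal O_0\subset\mathcal O$ the sub-$\mathcal O_0$-module spanned by $\mathrm{id}$. One has $\Sigma\langle V\rangle_{\mathcal O_0}=\langle\Sigma V\rangle_{\mathcal O_0}$, and in this way $\sigma\colon\langle V\rangle_{\mathcal O_0}\to\langle\Sigma V\rangle_{\mathcal O_0}\subset I\mathcal O$. $\mathcal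 O$ is linear if the differential restricted to $V$ takes values in $\mathcal O_0\oplus\langle V\rangle_{\mathcal O_0}\subset\mathcal O$; its components are denoted $d^0\colon V\to\mathcal O_0$ and $d^1\colon V\to\langle V\rangle_{\mathcal O_0}$. *)

(* Defs.v *)
From HB Require Import structures.
From mathcomp Require Import all_boot all_order all_algebra.
From mathcomp Require Import boolp classical_sets functions cardinality fsbigop.

Set Implicit Arguments.
Unset Strict Implicit.
Unset Printing Implicit Defensive.

Import Order.TTheory GRing.Theory.
Local Open Scope ring_scope.

Definition ksign (k : pzRingType) (a : int) : k := (-1) ^+ `|a|%N.
Arguments ksign {k} a.

(* A sequence of Z-graded k-modules X = {X(n)_a} is represented by the single
   k-module \bigoplus_(n, a) X(n)_a together with its submodules
   [homog n a] = X(n)_a; the last two axioms say that the sum is direct.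
   A map of sequences of degree e is then a linear map sending X(n)_a to
   Y(n)_(a + e).  In this way no transport along equalities of arities or
   degrees is ever needed. *)
Record gseq (k : comPzRingType) := GSeq {
  gseq_car :> lmodType k;
  homog : nat -> int -> gseq_car -> Prop;
  homog0 : forall n a, homog n a 0;
  homogP : forall n a (c : k) x y,
    homog n a x -> homog n a y -> homog n a (c *: x + y);
  homog_span : forall x, exists s : seq gseq_car,
    (forall y, y \in s -> exists n a, homog n a y) /\ x = \sum_(y <- s) y;
  homog_indep : forall (s : seq (nat * int)) (f : nat * int -> gseq_car),
    uniq s -> (forall j, homog j.1 j.2 (f j)) -> \sum_(j <- s) f j = 0 ->
    forall j, j \in s -> f j = 0 }.
Arguments homog {k g}.

Definition graded_map (k : comPzRingType) (e : int) (X Y : gseq k)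
    (f : X -> Y) : Prop :=
  (forall (c : k) x y, f (c *: x + y) = c *: f x + f y) /\
  (forall n a x, homog n a x -> homog n (a + e) (f x)).

Record dgseq (k : comPzRingType) := DGSeq {
  dgseq_gseq :> gseq k;
  dif : dgseq_gseq -> dgseq_gseq;
  dif_graded : graded_map (-1) dif;
  dif_dif : forall x, dif (dif x) = 0 }.
Arguments dif {k d}.

Definition chain_map (k : comPzRingType) (X Y : dgseq k) (f : X -> Y) : Prop :=
  graded_map 0 f /\ forall x, f (dif x) = dif (f x).

Record strong_pseudo_cylinder (k : comPzRingType) (X C : dgseq k)
    (i0 i1 : X -> C) (p : C -> X) (h : C -> C) : Prop := StrongPseudoCylinder {
  spc_i0_chain : chain_map i0;
  spc_i1_chain : chain_map i1;
  spc_p_chain : chain_map p;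
  spc_h_graded : graded_map 1 h;
  spc_homotopy : forall x, i0 (p x) - x = dif (h x) + h (dif x);
  spc_pi0 : forall x, p (i0 x) = x;
  spc_pi1 : forall x, p (i1 x) = x;
  spc_ph : forall x, p (h x) = 0;
  spc_hi0 : forall x, h (i0 x) = 0;
  spc_hh : forall x, h (h x) = 0 }.

Section Cylinder.
Variable k : comPzRingType.

Section Graded.
Variable X : gseq k.

(* the triple (x, s, y) stands for i0 x + sigma s + i1 y *)
Let C : lmodType k := (X * X * X)%type.

Definition cyl_homog n (a : int) (u : C) : Prop :=
  [/\ homog n a u.1.1, homog n (a - 1) u.1.2 & homog n a u.2].

Fact cyl_homog0 n a : cyl_homog n a 0.
Proof. by split; exact: homog0. Qed.

Fact cyl_homogP n a (c : k) u v :
  cyl_homog n a u -> cyl_homog n a v -> cyl_homog n a (c *: u + v).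
Proof. by case=> ? ? ? [? ? ?]; split; exact: homogP. Qed.

Definition cyl_i0 (x : X) : C := (x, 0, 0).
Definition cyl_s (x : X) : C := (0, x, 0).
Definition cyl_i1 (x : X) : C := (0, 0, x).
Definition cyl_p (u : C) : X := u.1.1 + u.2.
Definition cyl_h (u : C) : C := (0, u.2, 0).

Fact cyl_homog_span u : exists s : seq C,
  (forall y, y \in s -> exists n a, cyl_homog n a y) /\ u = \sum_(y <- s) y.
Proof.
case: u => [[x s] y].
have [sx [hx ->]] := homog_span x.
have [ss [hs ->]] := homog_span s.
have [sy [hy ->]] := homog_span y.
exists (map cyl_i0 sx ++ map cyl_s ss ++ map cyl_i1 sy); split.
  move=> z; rewrite !mem_cat => /or3P[] /mapP[w wI ->].
  - by have [n [a h]] := hx w wI; exists n, a; split=> //=; exact: homog0.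
  - have [n [a h]] := hs w wI; exists n, (a + 1); split=> /=; try exact: homog0.
    by rewrite addrK.
  - by have [n [a h]] := hy w wI; exists n, a; split=> //=; exact: homog0.
rewrite !big_cat /= !big_map.
have E0 r : \sum_(j <- r) cyl_i0 j = cyl_i0 (\sum_(j <- r) j).
  elim: r => [|w r IH]; first by rewrite !big_nil.
  by rewrite !big_cons IH; congr (_, _, _); rewrite /= ?addr0.
have Es r : \sum_(j <- r) cyl_s j = cyl_s (\sum_(j <- r) j).
  elim: r => [|w r IH]; first by rewrite !big_nil.
  by rewrite !big_cons IH; congr (_, _, _); rewrite /= ?addr0.
have E1 r : \sum_(j <- r) cyl_i1 j = cyl_i1 (\sum_(j <- r) j).
  elim: r => [|w r IH]; first by rewrite !big_nil.
  by rewrite !big_cons IH; congr (_, _, _); rewrite /= ?addr0.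
rewrite E0 Es E1; congr (_, _, _); rewrite /=.
- by rewrite !addr0.
- by rewrite add0r addr0.
- by rewrite !add0r.
Qed.

Fact cyl_homog_indep (s : seq (nat * int)) (f : nat * int -> C) :
  uniq s -> (forall j, cyl_homog j.1 j.2 (f j)) -> \sum_(j <- s) f j = 0 ->
  forall j, j \in s -> f j = 0.
Proof.
move=> us hf S0 j js.
have S r : \sum_(j <- r) f j =
    (\sum_(j <- r) (f j).1.1, \sum_(j <- r) (f j).1.2, \sum_(j <- r) (f j).2).
  elim: r => [|w r IH]; first by rewrite !big_nil.
  by rewrite !big_cons IH; case: (f w) => [[]].
move: S0; rewrite S => -[S1 S2 S3].
have E1 : (f j).1.1 = 0.
  apply: (@homog_indep _ X s (fun j => (f j).1.1)) js => //.
  by move=> i; case: (hf i).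
have E3 : (f j).2 = 0.
  apply: (@homog_indep _ X s (fun j => (f j).2)) js => //.
  by move=> i; case: (hf i).
pose sh (j : nat * int) := (j.1, j.2 - 1).
have shK : cancel sh (fun j => (j.1, j.2 + 1)).
  by case=> n a; rewrite /sh /= subrK.
have E2 : (f j).1.2 = 0.
  have := @homog_indep _ X (map sh s) (fun j => (f (j.1, j.2 + 1)).1.2).
  move=> /(_ _ _ _ (sh j)) /=; rewrite subrK -surjective_pairing; apply.
  - by rewrite map_inj_uniq //; exact: can_inj shK.
  - by move=> [n a]; have [] := hf (n, a + 1); rewrite /= addrK.
  - rewrite big_map -[RHS]S2; apply: eq_bigr => -[n a] _.
    by rewrite /= subrK.
  - exact: map_f.
by case: (f j) E1 E2 E3 => [[x y] z] /= -> -> ->.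
Qed.

Definition cyl_gseq : gseq k :=
  GSeq cyl_homog0 cyl_homogP cyl_homog_span cyl_homog_indep.

End Graded.

Variable X : dgseq k.

Definition cyl_dif (u : cyl_gseq X) : cyl_gseq X :=
  (dif u.1.1 + u.1.2, - dif u.1.2, dif u.2 - u.1.2).

Fact cyl_dif_graded : graded_map (-1) cyl_dif.
Proof.
have [dl dh] := dif_graded X; split.
  move=> c [[x s] y] [[x' s'] y']; rewrite /cyl_dif /= !dl.
  congr (_, _, _); rewrite /=.
  - by rewrite scalerDr addrACA.
  - by rewrite scalerN opprD.
  - by rewrite scalerBr opprD addrACA.
have hN n a (x : X) : homog n a x -> homog n a (- x).
  by move=> h; have := homogP (-1) h (homog0 X n a); rewrite scaleN1r addr0.
have hD n a (x y : X) : homog n a x -> homog n a y -> homog n a (x + y).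
  by move=> h h'; have := homogP 1 h h'; rewrite scale1r.
move=> n a [[x s] y] [/= hx hs hy]; split=> /=.
- by apply: hD => //; exact: dh.
- by apply: hN; exact: dh.
- by apply: hD; [exact: dh | exact: hN].
Qed.

Fact cyl_dif_dif u : cyl_dif (cyl_dif u) = 0.
Proof.
have [dl _] := dif_graded X.
have d0 : dif (0 : X) = 0.
  by have := dl (-1) 0 0; rewrite scaler0 addr0 scaleN1r addNr.
have dD (x y : X) : dif (x + y) = dif x + dif y.
  by have := dl 1 x y; rewrite !scale1r.
have dN (x : X) : dif (- x) = - dif x.
  by apply/eqP; rewrite -addr_eq0 -dD addNr d0.
case: u => [[x s] y]; rewrite /cyl_dif /= !dD !dN !dif_dif !oppr0 !add0r.
by congr (_, _, _); rewrite /= ?subrr.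
Qed.

Definition cyl : dgseq k := DGSeq cyl_dif_graded cyl_dif_dif.

End Cylinder.

Section DirectSum.
Variables (k : comPzRingType) (I : choiceType) (V : I -> gseq k).

Record dsum_car := DSum {
  dsum_fun :> forall i, V i;
  dsum_fin : finite_set [set i | dsum_fun i != 0]%classic }.

Lemma dsum_ext (x y : dsum_car) : (forall i, x i = y i) -> x = y.
Proof.
case: x y => [f hf] [g hg] /= E.
have {}E : f = g by apply: functional_extensionality_dep.
by case: g / E hg => hg; congr DSum; exact: Prop_irrelevance.
Qed.

HB.instance Definition _ := gen_eqMixin dsum_car.
HB.instance Definition _ := gen_choiceMixin dsum_car.

Fact dsum_fin0 : finite_set [set i | (0 : V i) != 0]%classic.
Proof.
by apply: (@sub_finite_set _ _ set0%classic) => // i /=; rewrite eqxx.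
Qed.
Definition dsum0 := DSum dsum_fin0.

Fact dsum_finN (x : dsum_car) : finite_set [set i | - x i != 0]%classic.
Proof.
by apply: (sub_finite_set _ (dsum_fin x)) => i /=; rewrite oppr_eq0.
Qed.
Definition dsumN x := DSum (dsum_finN x).

Fact dsum_finD (x y : dsum_car) : finite_set [set i | x i + y i != 0]%classic.
Proof.
have F : finite_set
    ([set i | x i != 0] `|` [set i | y i != 0])%classic.
  by rewrite finite_setU; split; exact: dsum_fin.
apply: (sub_finite_set _ F) => i /=.
have [->|] := eqVneq (x i) 0; last by left.
by rewrite add0r; right.
Qed.
Definition dsumD x y := DSum (dsum_finD x y).

Fact dsum_finZ (c : k) (x : dsum_car) :
  finite_set [set i | c *: x i != 0]%classic.
Proof.
apply: (sub_finite_set _ (dsum_fin x)) => i /=.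
by apply: contra_neq => ->; rewrite scaler0.
Qed.
Definition dsumZ c x := DSum (dsum_finZ c x).

Fact dsumA : associative dsumD.
Proof. by move=> x y z; apply: dsum_ext => i /=; rewrite addrA. Qed.
Fact dsumC : commutative dsumD.
Proof. by move=> x y; apply: dsum_ext => i /=; rewrite addrC. Qed.
Fact dsum0D : left_id dsum0 dsumD.
Proof. by move=> x; apply: dsum_ext => i /=; rewrite add0r. Qed.
Fact dsumND : left_inverse dsum0 dsumN dsumD.
Proof. by move=> x; apply: dsum_ext => i /=; rewrite addNr. Qed.

HB.instance Definition _ :=
  GRing.isZmodule.Build dsum_car dsumA dsumC dsum0D dsumND.

Fact dsumZA c d (x : dsum_car) : dsumZ c (dsumZ d x) = dsumZ (c * d) x.
Proof. by apply: dsum_ext => i /=; rewrite scalerA. Qed.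
Fact dsum1Z : left_id 1 dsumZ.
Proof. by move=> x; apply: dsum_ext => i /=; rewrite scale1r. Qed.
Fact dsumZDr : right_distributive dsumZ +%R.
Proof. by move=> c x y; apply: dsum_ext => i /=; rewrite scalerDr. Qed.
Fact dsumZDl (x : dsum_car) : {morph dsumZ^~ x : c d / c + d}.
Proof. by move=> c d; apply: dsum_ext => i /=; rewrite scalerDl. Qed.

HB.instance Definition _ :=
  GRing.Zmodule_isLmodule.Build k dsum_car dsumZA dsum1Z dsumZDr dsumZDl.

Fact dsum_inj_fin i (v : V i) :
  finite_set [set j | dfwith (fun j => 0 : V j) v j != 0]%classic.
Proof.
apply: (@sub_finite_set _ _ [set i]%classic) => // j /=.
by have [->//|ij] := eqVneq j i; rewrite dfwith_out ?eqxx// eq_sym.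
Qed.
Definition dsum_inj i (v : V i) : dsum_car := DSum (dsum_inj_fin v).

Definition dsum_homog n (a : int) (x : dsum_car) : Prop :=
  forall i, homog n a (x i).

Fact dsum_homog0 n a : dsum_homog n a 0.
Proof. by move=> i; exact: homog0. Qed.

Fact dsum_homogP n a (c : k) x y :
  dsum_homog n a x -> dsum_homog n a y -> dsum_homog n a (c *: x + y).
Proof. by move=> hx hy i; exact: homogP. Qed.

Fact dsum_sumE (J : Type) (s : seq J) (F : J -> dsum_car) i :
  (\sum_(j <- s) F j) i = \sum_(j <- s) F j i.
Proof.
by elim: s => [|j s IH]; rewrite ?big_nil// !big_cons -IH.
Qed.

Fact dsum_homog_span x : exists s : seq dsum_car,
  (forall y, y \in s -> exists n a, dsum_homog n a y) /\ x = \sum_(y <- s) y.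
Proof.
have [r0 Er] := (@finite_seqP _ _).1 (dsum_fin x).
pose r := undup r0.
have ur : uniq r by exact: undup_uniq.
have xr i : i \notin r -> x i = 0.
  rewrite mem_undup => /negP ir; apply/eqP/negP => /negP xi0; apply: ir.
  by have : [set i | x i != 0]%classic i by []; rewrite Er.
have -> : x = \sum_(i <- r) dsum_inj (x i).
  apply: dsum_ext => i; rewrite dsum_sumE.
  have [ir|ir] := boolP (i \in r).
    rewrite (bigD1_seq i) //= dfwith_in big1 ?addr0// => j ji.
    by rewrite /= dfwith_out.
  rewrite xr// big_seq big1// => j jr; rewrite /= dfwith_out//.
  by apply: contraNneq ir => <-.
elim: r {ur xr} => [|i r [s [hs Es]]].
  by exists [::]; rewrite !big_nil.
rewrite big_cons; have [u [hu Eu]] := homog_span (x i).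
exists (map (@dsum_inj i) u ++ s); split.
  move=> y; rewrite mem_cat => /orP[/mapP[v vu ->]|]; last exact: hs.
  have [n [a h]] := hu v vu; exists n, a => j /=.
  by case: dfwithP => // l _; exact: homog0.
rewrite big_cat -Es /= big_map Eu; congr (_ + _).
apply: dsum_ext => j; rewrite dsum_sumE /=.
have [ij|ij] := eqVneq i j.
  by case: j / ij; rewrite dfwith_in; apply: eq_bigr => v _; rewrite /= dfwith_in.
by rewrite dfwith_out// big1// => v _; rewrite /= dfwith_out.
Qed.

Fact dsum_homog_indep (s : seq (nat * int)) (f : nat * int -> dsum_car) :
  uniq s -> (forall j, dsum_homog j.1 j.2 (f j)) -> \sum_(j <- s) f j = 0 ->
  forall j, j \in s -> f j = 0.
Proof.
move=> us hf S0 j js; apply: dsum_ext => i.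
apply: (@homog_indep _ (V i) s (fun j => f j i)) js => //.
  by move=> l; exact: hf.
by rewrite -dsum_sumE S0.
Qed.

Definition dsum : gseq k :=
  GSeq dsum_homog0 dsum_homogP dsum_homog_span dsum_homog_indep.

Definition dsum_rec (M : lmodType k) (f : forall i, V i -> M) (x : dsum) : M :=
  \sum_(i \in [set: I]%classic) f i (x i).

Definition cyl_component (u : cyl_gseq dsum) i : cyl_gseq (V i) :=
  (u.1.1 i, u.1.2 i, u.2 i).

End DirectSum.

(* [comp i x y] is the composition of x and y along the i-th input; it is only
   meaningful for x of arity p >= i >= 1, the other values are junk. *)
Record operad (k : comPzRingType) := Operad {
  op_gseq :> gseq k;
  comp : nat -> op_gseq -> op_gseq -> op_gseq;
  op_id : op_gseq;
  op_id_homog : homog 1 0 op_id;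
  comp_linearl : forall i y (c : k) x x',
    comp i (c *: x + x') y = c *: comp i x y + comp i x' y;
  comp_linearr : forall i x (c : k) y y',
    comp i x (c *: y + y') = c *: comp i x y + comp i x y';
  comp_homog : forall p a q b i x y, homog p a x -> homog q b y ->
    (1 <= i <= p)%N -> homog (p + q - 1) (a + b) (comp i x y);
  comp_assoc : forall p a q b r c i j x y z,
    homog p a x -> homog q b y -> homog r c z ->
    (1 <= i <= p)%N -> (1 <= j <= q)%N ->
    comp i x (comp j y z) = comp (i + j - 1) (comp i x y) z;
  comp_comm : forall p a q b r c i j x y z,
    homog p a x -> homog q b y -> homog r c z ->
    (1 <= j)%N -> (j < i)%N -> (i <= p)%N ->
    comp j (comp i x y) z =
      ksign (b * c) *: comp (i + r - 1) (comp j x z) y;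
  comp_idl : forall q b y, homog q b y -> comp 1 op_id y = y;
  comp_idr : forall p a i x, homog p a x -> (1 <= i <= p)%N ->
    comp i x op_id = x }.
Arguments comp {k o}.
Arguments op_id {k o}.

Definition operad_map (k : comPzRingType) (P Q : operad k) (f : P -> Q) : Prop :=
  [/\ graded_map 0 f, f op_id = op_id &
      forall p a q b i x y, homog p a x -> homog q b y -> (1 <= i <= p)%N ->
        f (comp i x y) = comp i (f x) (f y)].

Definition leibniz (k : comPzRingType) (P : operad k) (D : P -> P) : Prop :=
  forall p a q b i x y, homog p a x -> homog q b y -> (1 <= i <= p)%N ->
    D (comp i x y) = comp i (D x) y + ksign a *: comp i x (D y).

Record dgoperad (k : comPzRingType) := DGOperad {
  dgo_op :> operad k;
  dgo_dif : dgo_op -> dgo_op;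
  dgo_dif_graded : graded_map (-1) dgo_dif;
  dgo_dif_dif : forall x, dgo_dif (dgo_dif x) = 0;
  dgo_leibniz : leibniz dgo_dif }.

Definition dgo_dgseq (k : comPzRingType) (P : dgoperad k) : dgseq k :=
  DGSeq (@dgo_dif_graded _ P) (@dgo_dif_dif _ P).
Coercion dgo_dgseq : dgoperad >-> dgseq.

Definition dgoperad_map (k : comPzRingType) (P Q : dgoperad k) (f : P -> Q) :
    Prop :=
  operad_map f /\ forall x, f (dgo_dif x) = dgo_dif (f x).

(* P is the coproduct of O and of the free operad F(V); an operad map out of
   F(V) amounts to a map of sequences out of V. *)
Definition is_coprod_free (k : comPzRingType) (O : operad k) (V : gseq k)
    (P : operad k) (jO : O -> P) (jV : V -> P) : Prop :=
  [/\ operad_map jO, graded_map 0 jV &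
      forall (Q : operad k) (f : O -> Q) (g : V -> Q),
        operad_map f -> graded_map 0 g ->
        exists! u : P -> Q,
          [/\ operad_map u, forall x, u (jO x) = f x & forall x, u (jV x) = g x]].

Record is_twisted_coprod (k : comPzRingType) (O : dgoperad k) (V : dgseq k)
    (bd : V -> O) (P : dgoperad k) (jO : O -> P) (jV : V -> P) : Prop :=
  IsTwistedCoprod {
  tc_bd_graded : graded_map (-1) bd;
  tc_bd_dif : forall x, bd (dif x) + dgo_dif (bd x) = 0;
  tc_coprod : is_coprod_free jO jV;
  tc_difO : forall x, dgo_dif (jO x) = jO (dgo_dif x);
  tc_difV : forall x, dgo_dif (jV x) = jV (dif x) + jO (bd x) }.

Definition is_derivation_ext (k : comPzRingType) (O : operad k) (V : gseq k)
    (bd : V -> O) (P : operad k) (jO : O -> P) (jV : V -> P) (D : P -> P) :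
    Prop :=
  [/\ graded_map (-1) D, leibniz D, forall x, D (jO x) = 0 &
      forall x, D (jV x) = jO (bd x)].

(* A planted planar tree with at least one inner vertex, given by its
   bottommost inner vertex and the subtrees above it from left to right, [None]
   being a leaf.  A label consists of a degree and of an element of O or V; the
   arity of a vertex is the number of its subtrees. *)
Inductive ltree (O V : Type) : Type :=
  LNode of int * (O + V) & seq (option (ltree O V)).

Section Trees.
Variables (k : comPzRingType).

(* the labels in the path order *)
Fixpoint labels (O V : Type) (t : ltree O V) : seq (int * (O + V)) :=
  let: LNode l ts := t in
  l :: flatten (map (fun o => if o is Some c then labels c else [::]) ts).

Fixpoint nleaves (O V : Type) (t : ltree O V) : nat :=
  let: LNode _ ts := t in
  sumn (map (fun o => if o is Some c then nleaves c else 1%N) ts).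

(* apply [f j] to the j-th label in the path order, counting from m *)
Fixpoint map_labels (O V : Type) (f : nat -> int * (O + V) -> int * (O + V))
    (m : nat) (t : ltree O V) : ltree O V :=
  let: LNode l ts := t in
  LNode (f m l)
    ((fix go m (ts : seq (option (ltree O V))) :=
      match ts with
      | [::] => [::]
      | None :: ts' => None :: go m ts'
      | Some c :: ts' =>
          Some (map_labels f m c) :: go (m + size (labels c))%N ts'
      end) m.+1 ts).

(* [lvl_odd] tells whether the bottommost inner vertex has odd level; labels at
   odd (resp. even) level are in O (resp. V), and leaves have even level *)
Fixpoint admissible (O V : gseq k) (lvl_odd : bool) (t : ltree O V) : Prop :=
  let: LNode l ts := t in
  match l.2 with
  | inl x => lvl_odd /\ homog (size ts) l.1 x
  | inr v => ~~ lvl_odd /\ homog (size ts) l.1 v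
  end /\
  (fix go (ts : seq (option (ltree O V))) : Prop :=
    match ts with
    | [::] => True
    | None :: ts' => lvl_odd /\ go ts'
    | Some c :: ts' => admissible (~~ lvl_odd) c /\ go ts'
    end) ts.

(* The iterated composition of the labels, taken in the path order (hence
   without signs): the subtrees are grafted from left to right, i being the
   current position of the input to be filled. *)
Fixpoint tree_eval (O V : gseq k) (P : operad k) (jO : O -> P) (jV : V -> P)
    (t : ltree O V) : P :=
  let: LNode l ts := t in
  (fix go (i : nat) (acc : P) (ts : seq (option (ltree O V))) : P :=
    match ts with
    | [::] => acc
    | None :: ts' => go i.+1 acc ts'
    | Some c :: ts' =>
        go (i + nleaves c)%N (comp i acc (tree_eval jO jV c)) ts'
    end) 1%N (match l.2 with inl x => jO x | inr v => jV v end) ts.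

End Trees.

Record op_cylinder (k : comPzRingType) (O : dgoperad k) := OpCylinder {
  oc_op :> dgoperad k;
  oc_i0 : O -> oc_op;
  oc_i1 : O -> oc_op;
  oc_p : oc_op -> O;
  oc_h : oc_op -> oc_op;
  oc_i0_map : dgoperad_map oc_i0;
  oc_i1_map : dgoperad_map oc_i1;
  oc_p_map : dgoperad_map oc_p;
  oc_spc : @strong_pseudo_cylinder k O oc_op oc_i0 oc_i1 oc_p oc_h }.
Arguments oc_i0 {k O}.
Arguments oc_i1 {k O}.
Arguments oc_p {k O}.
Arguments oc_h {k O}.

Section TrivialCylinder.
Variables (k : comPzRingType) (O : dgoperad k).

Fact id_dgoperad_map : dgoperad_map (id : O -> O).
Proof. by split=> //; split=> //; split=> // n a x; rewrite addr0. Qed.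

Fact trivial_spc : @strong_pseudo_cylinder k O O id id id (fun _ => 0).
Proof.
have [dl _] := dgo_dif_graded O.
have d0 : dgo_dif (0 : O) = 0.
  by have := dl (-1) 0 0; rewrite scaler0 addr0 scaleN1r addNr.
have hid : @chain_map k O O id.
  by split=> //; split=> // n a x; rewrite addr0.
split=> //.
  split; first by move=> c x y; rewrite scaler0 addr0.
  by move=> n a x _; exact: homog0.
by move=> x; rewrite /= subrr d0 addr0.
Qed.

Definition trivial_cylinder : op_cylinder O :=
  OpCylinder id_dgoperad_map id_dgoperad_map id_dgoperad_map trivial_spc.

End TrivialCylinder.

Section InducedCylinder.
Variables (k : comPzRingType) (O : dgoperad k) (P : op_cylinder O).
Variables (V : dgseq k) (bd : V -> O).

Definition label_i0p (l : int * (P + cyl V)) : int * (P + cyl V) :=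
  (l.1, match l.2 with
        | inl y => inl (oc_i0 P (oc_p P y))
        | inr w => inr (cyl_i0 (cyl_p w) : cyl V)
        end).

Definition label_h (l : int * (P + cyl V)) : int * (P + cyl V) :=
  (l.1 + 1, match l.2 with
            | inl y => inl (oc_h P y)
            | inr w => inr (cyl_h w : cyl V)
            end).

Definition is_tree_homotopy (Q : operad k) (jP : P -> Q) (jV : cyl V -> Q)
    (h : Q -> Q) : Prop :=
  graded_map 1 h /\
  forall t : ltree P (cyl V), admissible true t ->
    h (tree_eval jP jV t) =
    \sum_(m < size (labels t))
      ksign (\sum_(l <- take m (labels t)) l.1) *:
      tree_eval jP jV
        (map_labels (fun j => if (j < m)%N then label_i0p
                              else if j == m then label_h else id) 0 t).

(* i0 x |-> i0 (bd x), sigma x |-> - h (i1 (bd x)), i1 x |-> i1 (bd x) *)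
Definition bd_cyl (u : cyl V) : P :=
  oc_i0 P (bd u.1.1) - oc_h P (oc_i1 P (bd u.1.2)) + oc_i1 P (bd u.2).

(* P' is the strong pseudo-cylinder of O' = O +_bd F(V) induced by P *)
Record is_induced_cylinder (O' : dgoperad k) (jO : O -> O') (jV : V -> O')
    (P' : op_cylinder O') (jP : P -> P') (jIV : cyl V -> P') : Prop :=
  IsInducedCylinder {
  ic_coprod : is_twisted_coprod bd_cyl jP jIV;
  ic_i0O : forall x, oc_i0 P' (jO x) = jP (oc_i0 P x);
  ic_i0V : forall x, oc_i0 P' (jV x) = jIV (cyl_i0 x);
  ic_i1O : forall x, oc_i1 P' (jO x) = jP (oc_i1 P x);
  ic_i1V : forall x, oc_i1 P' (jV x) = jIV (cyl_i1 x);
  ic_pO : forall y, oc_p P' (jP y) = jO (oc_p P y);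
  ic_pV : forall w, oc_p P' (jIV w) = jV (cyl_p w);
  ic_h : exists h D : P' -> P',
    [/\ is_tree_homotopy jP jIV h, is_derivation_ext bd_cyl jP jIV D &
        forall y, exists N, forall m, (N <= m)%N ->
          oc_h P' y = \sum_(n < m) iter n (fun z => h (D z)) (h y)] }.

End InducedCylinder.

(* An ordinal \alpha is represented by the well-ordered set A of all ordinals
   \beta <= \alpha: \bot is 0 and \top is \alpha. *)
Section Ordinals.
Variables (disp : Order.disp_t) (A : tbOrderType disp).

(* \beta + 1 (and \top for \beta = \top, which is never used) *)
Definition osucc (b : A) : A :=
  xget \top%O [set c : A | (b < c)%O /\ forall d, (b < d)%O -> (c <= d)%O]%classic.

Fact le_osucc b : (b <= osucc b)%O.
Proof.
rewrite /osucc; case: xgetP => [c _ [/ltW]//|_]; exact: lex1.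
Qed.

Definition is_limit (b : A) : Prop :=
  (\bot < b)%O /\ forall c, (c < b)%O -> (osucc c < b)%O.

Definition below_top := {b : A | (b < \top)%O}.
HB.instance Definition _ := Choice.on below_top.

End Ordinals.

Section Systems.
Variables (k : comPzRingType) (disp : Order.disp_t) (A : tbOrderType disp).
Variables (P : A -> dgoperad k) (tr : forall b c, (b <= c)%O -> P b -> P c).

Definition is_system : Prop :=
  [/\ forall b c (bc : (b <= c)%O), dgoperad_map (tr bc),
      forall b (bb : (b <= b)%O) x, tr bb x = x &
      forall b c d (bc : (b <= c)%O) (cd : (c <= d)%O) (bd : (b <= d)%O) x,
        tr cd (tr bc x) = tr bd x].

(* P b is the colimit of the P c, c < b; such directed colimits are computed on
   the underlying modules *)
Definition is_colim_at (b : A) : Prop :=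
  (forall x : P b, exists c (cb : (c < b)%O) (y : P c), tr (ltW cb) y = x) /\
  (forall c (cb : (c < b)%O) (y : P c), tr (ltW cb) y = 0 ->
    exists d (cd : (c <= d)%O), (d < b)%O /\ tr cd y = 0).

End Systems.

(* The operad itself is [pc_op X \top]. *)
Record pseudo_cellular (k : comPzRingType) (disp : Order.disp_t)
    (A : tbOrderType disp) := PseudoCellular {
  pc_op :> A -> dgoperad k;
  pc_tr : forall b c : A, (b <= c)%O -> pc_op b -> pc_op c;
  pc_V : below_top A -> dgseq k;
  pc_bd : forall b : below_top A, pc_V b -> pc_op (val b);
  pc_gen : forall b : below_top A, pc_V b -> pc_op (osucc (val b));
  pc_system : is_system pc_tr;
  pc_increasing : forall b c (bc : (b <= c)%O), injective (pc_tr bc);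
  pc_limit : forall b, is_limit b -> is_colim_at pc_tr b;
  pc_succ : forall b : below_top A,
    is_twisted_coprod (@pc_bd b) (pc_tr (le_osucc (val b))) (@pc_gen b) }.
Arguments pc_V {k disp A} p b.
Arguments pc_tr {k disp A} p {b c}.
Arguments pc_bd {k disp A} p b.
Arguments pc_gen {k disp A} p b.

(* The canonical strong pseudo-cylinders of the stages; the one of the operad
   itself is [cc_cyl Y \top]. *)
Record canonical_cylinder (k : comPzRingType) (disp : Order.disp_t)
    (A : tbOrderType disp) (X : pseudo_cellular k A) := CanonicalCylinder {
  cc_cyl :> forall b : A, op_cylinder (X b);
  cc_tr : forall b c : A, (b <= c)%O -> cc_cyl b -> cc_cyl c;
  cc_gen : forall b : below_top A, cyl (pc_V X b) -> cc_cyl (osucc (val b));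
  cc_system : @is_system k disp A cc_cyl cc_tr;
  cc_zero : cc_cyl \bot%O = trivial_cylinder (X \bot%O);
  cc_limit : forall b, is_limit b -> @is_colim_at k disp A cc_cyl cc_tr b;
  cc_limit_maps : forall b, is_limit b -> forall c (cb : (c < b)%O),
    [/\ forall x, oc_i0 (cc_cyl b) (pc_tr X (ltW cb) x) =
                  cc_tr (ltW cb) (oc_i0 (cc_cyl c) x),
        forall x, oc_i1 (cc_cyl b) (pc_tr X (ltW cb) x) =
                  cc_tr (ltW cb) (oc_i1 (cc_cyl c) x),
        forall y, oc_p (cc_cyl b) (cc_tr (ltW cb) y) =
                  pc_tr X (ltW cb) (oc_p (cc_cyl c) y) &
        forall y, oc_h (cc_cyl b) (cc_tr (ltW cb) y) =
                  cc_tr (ltW cb) (oc_h (cc_cyl c) y)];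
  cc_succ : forall b : below_top A,
    is_induced_cylinder (pc_bd X b)
      (pc_tr X (le_osucc (val b))) (pc_gen X b)
      (cc_tr (le_osucc (val b))) (@cc_gen b) }.
Arguments cc_cyl {k disp A X} Y b : rename.
Arguments cc_tr {k disp A X} Y {b c} : rename.
Arguments cc_gen {k disp A X} Y b : rename.

Section Submodules.
Variables (k : comPzRingType) (O P : operad k) (j : O -> P).

(* P is seen as an O-module through j. *)
Record is_submodule (N : P -> Prop) : Prop := IsSubmodule {
  sm0 : N 0;
  smP : forall (c : k) x y, N x -> N y -> N (c *: x + y);
  sm_right : forall p a q b i x y, homog p a x -> homog q b y ->
    (1 <= i <= p)%N -> N x -> N (comp i x (j y));
  sm_left : forall p a q b i x y, homog p a x -> homog q b y ->
    (1 <= i <= q)%N -> N x -> N (comp i (j y) x) }.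

Definition spanned (S : P -> Prop) (x : P) : Prop :=
  forall N, is_submodule N -> (forall y, S y -> N y) -> N x.

End Submodules.

Section Generators.
Variables (k : comPzRingType) (disp : Order.disp_t) (A : tbOrderType disp).
Variable (X : pseudo_cellular k A).

Definition gens : gseq k := dsum (fun b : below_top A => dgseq_gseq (pc_V X b)).

Definition base_incl : X \bot%O -> X \top%O := pc_tr X (le0x \top%O).

Definition gens_incl : gens -> X \top%O :=
  dsum_rec (fun (b : below_top A) v => pc_tr X (lex1 _) (pc_gen X b v)).

Definition base_span (z : X \top%O) : Prop :=
  spanned base_incl (fun y => exists x, y = gens_incl x) z.

(* The decomposition of the differential on V as an element of
   O_0 + <V> is unique, as the sum is direct. *)
Definition linear_with (d0 : gens -> X \bot%O) (d1 : gens -> X \top%O) : Prop :=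
  forall x, dgo_dif (gens_incl x) = base_incl (d0 x) + d1 x /\ base_span (d1 x).

Variable (Y : canonical_cylinder X).

Definition cyl_base_incl (x : X \bot%O) : Y \top%O :=
  cc_tr Y (le0x \top%O) (oc_i0 (Y \bot%O) x).

Definition cyl_gens_incl (u : cyl_gseq gens) : Y \top%O :=
  \sum_(b \in [set: below_top A]%classic)
    cc_tr Y (lex1 _) (cc_gen Y b (cyl_component u b : cyl (pc_V X b))).

(* s is the suspension of O_0-modules <V> -> <Sigma V>, with values in IO; only
   its restriction to <V> matters *)
Record is_suspension (s : X \top%O -> Y \top%O) : Prop := IsSuspension {
  susp_gens : forall x : gens, s (gens_incl x) = cyl_gens_incl (cyl_s x);
  suspP : forall (c : k) x y, base_span x -> base_span y ->
    s (c *: x + y) = c *: s x + s y;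
  susp_homog : forall n a x, base_span x -> homog n a x -> homog n (a + 1) (s x);
  susp_right : forall p a q b i x y, base_span x -> homog p a x ->
    homog q b y -> (1 <= i <= p)%N ->
    s (comp i x (base_incl y)) = comp i (s x) (cyl_base_incl y);
  susp_left : forall p a q b i x y, base_span x -> homog p a x ->
    homog q b y -> (1 <= i <= q)%N ->
    s (comp i (base_incl y) x) = ksign b *: comp i (cyl_base_incl y) (s x) }.

End Generators.

(* Main.v *)
(* Let h and i1 be the homotopy and the second inclusion of the canonical
   cylinder IO.  The suspension of O_0-modules is sigma := h i1: the identity
   i0 p - 1 = d h + h d at i1 x then reads
     d (sigma x) = i0 x - i1 x - sigma (d x),
   and sigma vanishes on O_0.  What has to be shown is that h is linear over O_0
   and that h (i1 x) is the generator sigma x of IO, both by transfinite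
   induction.  A successor stage is spanned by trees, because the span of the
   trees is stable under right composition with generators.  On trees one sees
   that if h_P is O_0-linear, so is the tree homotopy h_(P, V), hence so is the
   perturbed homotopy, as the derivation extending bd_I vanishes on O_0; and the
   perturbation does not contribute to h (i1 x) because h_P^2 = 0. *)
From HB Require Import structures.
From mathcomp Require Import all_boot all_order all_algebra.
From mathcomp Require Import boolp classical_sets functions cardinality fsbigop.
From mathcomp Require Import ring zify.
Require Import Defs.

Set Implicit Arguments.
Unset Strict Implicit.
Unset Printing Implicit Defensive.

Import Order.TTheory GRing.Theory.
Local Open Scope ring_scope.

(** * Linear maps and homogeneous components *)

(** The coproduct is given only by its universal property and its homotopy only by values on trees,
    so induction over its elements has to be derived, by mapping into suboperads. The main obstacle
    is signs. To compare [h (x o z)] with [(h x) o z] for x a tree, the composite must be rewritten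
    as a tree, which produces Koszul signs from crossing subtrees, on top of those in the sum over
    the path order. None of them is computed: evaluating a tree in triangular matrices yields x,
    [h x] and the image of x under [i0 p] (up to sign) at once, and rewriting [x o z] as [s] times a
    tree inside matrices gives one scalar [s] for all entries. The price is that triangular matrices
    violate the axiom on parallel compositions. It survives when one of the two grafted factors is
    diagonal with entries equal up to the Koszul sign, which is the matrix of z in O_0, as
    [i0 p z = z] and [h z = 0]. Hence the calculus of trees is set up over preoperads, with the
    parallel axiom assumed for z alone. *)

Section Linear.
Variables (k : comPzRingType) (U W : lmodType k) (f : U -> W).

Definition lin : Prop := forall (c : k) x y, f (c *: x + y) = c *: f x + f y.

Hypothesis fL : lin.

Lemma linD x y : f (x + y) = f x + f y.
Proof. by have := fL 1 x y; rewrite !scale1r. Qed.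

Lemma lin0 : f 0 = 0.
Proof. by apply: (addrI (f 0)); rewrite -linD !addr0. Qed.

Lemma linZ c x : f (c *: x) = c *: f x.
Proof. by have := fL c x 0; rewrite lin0 !addr0. Qed.

Lemma linN x : f (- x) = - f x.
Proof. by rewrite -!scaleN1r linZ. Qed.

Lemma linB x y : f (x - y) = f x - f y.
Proof. by rewrite linD linN. Qed.

Lemma lin_sum (I : Type) (r : seq I) (Q : pred I) (F : I -> U) :
  f (\sum_(i <- r | Q i) F i) = \sum_(i <- r | Q i) f (F i).
Proof. exact: (big_morph f linD lin0). Qed.

End Linear.
Arguments lin_sum {k U W f}.

(** A sum over [setT] is 0 by convention when its support is infinite, so a finite list containing
    the support has to be supplied. *)
Lemma lin_fsum (k : comPzRingType) (W : lmodType k) (I : choiceType)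
    (r : seq I) (F : I -> W) : uniq r -> (forall i, i \notin r -> F i = 0) ->
  \sum_(i \in [set: I]%classic) F i = \sum_(i <- r) F i.
Proof.
move=> ur F0; rewrite (fsbigE r)// => [|i _]; last exact: F0.
by under eq_bigl do rewrite in_setT.
Qed.

Section Components.
Variables (k : comPzRingType) (X : gseq k).

Lemma homogZ n a (c : k) (x : X) : homog n a x -> homog n a (c *: x).
Proof. by move=> h; have := homogP c h (homog0 X n a); rewrite addr0. Qed.

Lemma homogD n a (x y : X) : homog n a x -> homog n a y -> homog n a (x + y).
Proof. by move=> h h'; have := homogP 1 h h'; rewrite scale1r. Qed.

Lemma homog_sum n a (I : eqType) (r : seq I) (F : I -> X) :
  (forall i, i \in r -> homog n a (F i)) -> homog n a (\sum_(i <- r) F i).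
Proof.
move=> h; rewrite big_seq; apply: big_ind => //; first exact: homog0.
exact: homogD.
Qed.

Definition decomposes (x : X) (f : nat * int -> X) : Prop :=
  (forall j, homog j.1 j.2 (f j)) /\
  exists s, [/\ uniq s, forall j, j \notin s -> f j = 0 &
                x = \sum_(j <- s) f j].

Let widen (s s' : seq (nat * int)) (f : nat * int -> X) :
  uniq s -> uniq s' -> {subset s <= s'} -> (forall j, j \notin s -> f j = 0) ->
  \sum_(j <- s) f j = \sum_(j <- s') f j.
Proof.
move=> us us' ss f0; rewrite -!lin_fsum// => j js'.
by apply: f0; apply: contra js'; exact: ss.
Qed.

Lemma decomposesP (c : k) x y f g : decomposes x f -> decomposes y g ->
  decomposes (c *: x + y) (fun j => c *: f j + g j).
Proof.
move=> [hf [s [us f0 ->]]] [hg [s' [us' g0 ->]]].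
split; first by move=> j; exact: homogP.
have uu := undup_uniq (s ++ s').
have sub1 : {subset s <= undup (s ++ s')}.
  by move=> j js; rewrite mem_undup mem_cat js.
have sub2 : {subset s' <= undup (s ++ s')}.
  by move=> j js; rewrite mem_undup mem_cat js orbT.
exists (undup (s ++ s')); split=> //.
  move=> j; rewrite mem_undup mem_cat negb_or => /andP[js js'].
  by rewrite f0// g0// scaler0 addr0.
by rewrite (widen us uu)// (widen us' uu)// big_split /= scaler_sumr.
Qed.

Lemma decomposes0 f : decomposes 0 f -> f = fun=> 0.
Proof.
move=> [hf [s [us f0 E]]]; apply: functional_extensionality_dep => j.
by have [js|/f0//] := boolP (j \in s); exact: (homog_indep us hf (esym E)).
Qed.

Lemma decomposes_inj x f g : decomposes x f -> decomposes x g -> f = g.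
Proof.
move=> hf hg; have := decomposesP (-1) hf hg; rewrite scaleN1r addNr.
move=> /decomposes0 E; apply: functional_extensionality_dep => j.
by have /(congr1 (fun h => h j)) := E; rewrite scaleN1r addrC => /subr0_eq.
Qed.

Lemma decomposes_homog n a x : homog n a x ->
  decomposes x (fun j => if j == (n, a) then x else 0).
Proof.
move=> hx; split; first by move=> j; case: eqP => [->|_]//; exact: homog0.
exists [:: (n, a)]; split=> //; last by rewrite big_seq1 eqxx.
by move=> j; rewrite inE => /negbTE ->.
Qed.

Lemma decomposes_ex x : exists f, decomposes x f.
Proof.
have [s [hs ->]] := homog_span x.
elim: s hs => [|y s IH] hs.
  exists (fun=> 0); rewrite big_nil; split; first by move=> j; exact: homog0.
  by exists [::]; rewrite big_nil.
have [|f hf] := IH; first by move=> z zs; apply: hs; rewrite inE zs orbT.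
have [n [a hy]] := hs y (mem_head _ _).
rewrite big_cons -[y]scale1r.
by eexists; exact: decomposesP (decomposes_homog hy) hf.
Qed.

(** A [gseq] comes with spanning and independence but no projections; these are obtained by choice,
    and their linearity rests on the uniqueness [decomposes_inj]. *)
Definition cpt (j : nat * int) (x : X) : X := sval (cid (decomposes_ex x)) j.

Lemma cptP x : decomposes x (cpt^~ x).
Proof. by rewrite /cpt; case: cid => f []. Qed.

Lemma cpt_homog j x : homog j.1 j.2 (cpt j x).
Proof. by have [h _] := cptP x; exact: h. Qed.

Lemma cpt_lin j : lin (cpt j).
Proof.
move=> c x y.
exact: (congr1 (fun h => h j)
  (decomposes_inj (cptP _) (decomposesP c (cptP x) (cptP y)))).
Qed.

Lemma cpt_of_homog j n a x : homog n a x ->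
  cpt j x = if j == (n, a) then x else 0.
Proof.
move=> h.
exact: (congr1 (fun h => h j) (decomposes_inj (cptP _) (decomposes_homog h))).
Qed.

Lemma cpt_id n a x : homog n a x -> cpt (n, a) x = x.
Proof. by move=> h; rewrite (cpt_of_homog _ h) eqxx. Qed.

Lemma cpt_sum x : exists s, [/\ uniq s, forall j, j \notin s -> cpt j x = 0 &
  x = \sum_(j <- s) cpt j x].
Proof. by have [_ h] := cptP x. Qed.

Lemma homog_ind (N : X -> Prop) : N 0 ->
  (forall x y, N x -> N y -> N (x + y)) ->
  (forall n a x, homog n a x -> N x) -> forall x, N x.
Proof.
move=> N0 ND Nh x; have [s [_ _ ->]] := cpt_sum x.
by apply: big_ind => // j _; apply: Nh (cpt_homog j x).
Qed.

Lemma lin_ext (W : lmodType k) (f g : X -> W) : lin f -> lin g ->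
  (forall n a x, homog n a x -> f x = g x) -> forall x, f x = g x.
Proof.
move=> fL gL E; apply: homog_ind => //; first by rewrite !lin0.
by move=> x y Ex Ey; rewrite !linD// Ex Ey.
Qed.

End Components.

Section OperadBasics.
Variables (k : comPzRingType) (P : operad k).

Lemma comp_linl i (y : P) : lin (fun x : P => comp i x y).
Proof. by move=> c x x'; exact: comp_linearl. Qed.

Lemma comp_linr i (x : P) : lin (comp i x).
Proof. by move=> c y y'; exact: comp_linearr. Qed.

Lemma comp0l i (y : P) : comp i 0 y = 0.
Proof. exact: lin0 (comp_linl i y). Qed.

Lemma comp0r i (x : P) : comp i x 0 = 0.
Proof. exact: lin0 (comp_linr i x). Qed.

Lemma operad_map_id : operad_map (id : P -> P).
Proof. by split=> //; split=> // n a x; rewrite addr0. Qed.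

End OperadBasics.

Lemma graded0_homog (k : comPzRingType) (X Z : gseq k) (f : X -> Z) n a x :
  graded_map 0 f -> homog n a x -> homog n a (f x).
Proof. by move=> [_ h] /h; rewrite addr0. Qed.

Lemma graded_comp (k : comPzRingType) d e (X Z W : gseq k) (f : X -> Z)
    (g : Z -> W) : graded_map d f -> graded_map e g ->
  graded_map (d + e) (fun x => g (f x)).
Proof.
move=> [fl fh] [gl gh]; split; first by move=> c x y; rewrite fl gl.
by move=> n a x /fh/gh; rewrite addrA.
Qed.

Lemma operad_map_comp (k : comPzRingType) (P Q S : operad k) (f : P -> Q)
    (g : Q -> S) : operad_map f -> operad_map g ->
  operad_map (fun x => g (f x)).
Proof.
move=> [fg f1 fc] [gg g1 gc]; split.
- by have := graded_comp fg gg; rewrite addr0.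
- by rewrite f1 g1.
- move=> p a q b i x y hx hy ip.
  rewrite (fc p a q b)// (gc p a q b)//; exact: graded0_homog.
Qed.

(** * Induction over the elements of a coproduct *)

Section Suboperad.
Variables (k : comPzRingType) (P : operad k).
Variable N : nat -> int -> P -> Prop.
Hypothesis N0 : forall n a, N n a 0.
Hypothesis NP : forall n a (c : k) x y,
  N n a x -> N n a y -> N n a (c *: x + y).
Hypothesis N1 : N 1 0 op_id.
Hypothesis NM : forall p a q b i x y, homog p a x -> homog q b y ->
  N p a x -> N q b y -> (1 <= i <= p)%N -> N (p + q - 1) (a + b) (comp i x y).

(** [N] is closed under composition only for homogeneous elements. Testing it on every component
    gives a submodule that is the sum of its homogeneous parts. *)
Definition sub_pred : {pred P} :=
  [pred x | `[< forall j : nat * int, N j.1 j.2 (cpt j x) >]].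

Lemma sub_predP x : reflect (forall j, N j.1 j.2 (cpt j x)) (x \in sub_pred).
Proof. exact: asboolP. Qed.

Fact sub_submod_closed : submod_closed sub_pred.
Proof.
split; first by apply/sub_predP => j; rewrite (lin0 (@cpt_lin _ P j)).
move=> c x y /sub_predP hx /sub_predP hy; apply/sub_predP => j.
by rewrite cpt_lin; exact: NP.
Qed.
HB.instance Definition _ :=
  GRing.isSubmodClosed.Build k P sub_pred sub_submod_closed.

Definition sub_car := {x : P | x \in sub_pred}.
HB.instance Definition _ :=
  [isSub of sub_car for @sval P (fun x => x \in sub_pred)].
HB.instance Definition _ := [Choice of sub_car by <:].
HB.instance Definition _ := [SubChoice_isSubLmodule of sub_car by <:].

Let subL : lmodType k := sub_car.

Definition mksub x (h : x \in sub_pred) : subL := exist _ x h.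


Lemma sub_homog_in n a x : homog n a x -> N n a x -> x \in sub_pred.
Proof.
move=> hx Nx; apply/sub_predP => j; rewrite (cpt_of_homog j hx).
by case: eqP => [->//|_]; exact: N0.
Qed.

Lemma sub_homogN n a x : homog n a x -> x \in sub_pred -> N n a x.
Proof. by move=> hx /sub_predP/(_ (n, a)); rewrite (cpt_id hx). Qed.

Definition sub_homog n a (x : subL) : Prop := homog n a (val x).

Fact sub_homog0 n a : sub_homog n a 0.
Proof. exact: homog0. Qed.

Fact sub_homogP n a (c : k) x y :
  sub_homog n a x -> sub_homog n a y -> sub_homog n a (c *: x + y).
Proof. exact: homogP. Qed.

Lemma val_sum_sub (I : Type) (s : seq I) (F : I -> subL) :
  val (\sum_(i <- s) F i) = \sum_(i <- s) val (F i).
Proof. exact: (@lin_sum _ subL P val). Qed.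

Fact sub_homog_span (x : subL) : exists s : seq subL,
  (forall y, y \in s -> exists n a, sub_homog n a y) /\ x = \sum_(y <- s) y.
Proof.
have [s [us s0 E]] := cpt_sum (val x).
have h j : cpt j (val x) \in sub_pred.
  by apply: (sub_homog_in (cpt_homog j _)); have /sub_predP := valP x.
exists [seq mksub (h j) | j <- s]; split.
  by move=> y /mapP[j _ ->]; exists j.1, j.2; exact: cpt_homog.
by apply: val_inj; rewrite big_map val_sum_sub.
Qed.

Fact sub_homog_indep (s : seq (nat * int)) (f : nat * int -> subL) :
  uniq s -> (forall j, sub_homog j.1 j.2 (f j)) -> \sum_(j <- s) f j = 0 ->
  forall j, j \in s -> f j = 0.
Proof.
move=> us hf S0 j js; apply: val_inj.
apply: (@homog_indep _ P s (fun j => val (f j)) us hf _ j js).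
by rewrite -val_sum_sub S0.
Qed.

Definition sub_gseq : gseq k :=
  GSeq sub_homog0 sub_homogP sub_homog_span sub_homog_indep.

(* [comp i x y] is junk on the part of x of arity < i, which has to be cut off
   for the composition to be defined on the whole carrier. *)
Definition trunc i (x : P) : P :=
  \sum_(j \in [set: nat * int]%classic)
    if (1 <= i <= j.1)%N then cpt j x else 0.

Lemma truncE i x s : uniq s -> (forall j, j \notin s -> cpt j x = 0) ->
  trunc i x = \sum_(j <- s) if (1 <= i <= j.1)%N then cpt j x else 0.
Proof. by move=> us s0; apply: lin_fsum => // j /s0 ->; case: ifP. Qed.

Lemma trunc_lin i : lin (trunc i).
Proof.
move=> c x y.
have [s [us s0 _]] := cpt_sum x; have [s' [us' s0' _]] := cpt_sum y.
have uu := undup_uniq (s ++ s').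
have out j : j \notin undup (s ++ s') -> cpt j x = 0 /\ cpt j y = 0.
  by rewrite mem_undup mem_cat negb_or => /andP[/s0 -> /s0' ->].
rewrite !(truncE i uu) => [|j /out[]|j /out[]|j /out[cx cy]]//.
  rewrite scaler_sumr -big_split; apply: eq_bigr => j _ /=.
  by case: ifP => _; rewrite ?cpt_lin// scaler0 addr0.
by rewrite cpt_lin cx cy scaler0 addr0.
Qed.

Lemma trunc_id p a i x : homog p a x -> (1 <= i <= p)%N -> trunc i x = x.
Proof.
move=> hx ip; rewrite (@truncE _ _ [:: (p, a)])//.
  by rewrite big_seq1 ip (cpt_id hx).
by move=> j; rewrite inE (cpt_of_homog j hx) => /negbTE ->.
Qed.

Fact sub_comp_closed i (x y : subL) :
  comp i (trunc i (val x)) (val y) \in sub_pred.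
Proof.
have [s [us s0 _]] := cpt_sum (val x); have [s' [_ _ ->]] := cpt_sum (val y).
rewrite (truncE i us s0) (lin_sum (comp_linr i _)) rpred_sum// => l _.
rewrite (lin_sum (comp_linl i _)) rpred_sum// => j _.
case: ifP => [ij|_]; last by rewrite comp0l rpred0.
have hx := cpt_homog j (val x); have hy := cpt_homog l (val y).
apply: sub_homog_in (comp_homog hx hy ij) _; apply: NM => //.
  by have /sub_predP := valP x.
by have /sub_predP := valP y.
Qed.

Definition sub_comp i (x y : sub_gseq) : sub_gseq :=
  mksub (sub_comp_closed i x y).

Definition sub_id : sub_gseq :=
  mksub (sub_homog_in (op_id_homog P) N1).

Lemma val_sub_comp p a i (x y : sub_gseq) : homog p a x -> (1 <= i <= p)%N ->
  val (sub_comp i x y) = comp i (val x) (val y).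
Proof. by move=> hx ip /=; rewrite (trunc_id hx). Qed.

Fact sub_comp_homog p a q b i (x y : sub_gseq) : homog p a x -> homog q b y ->
  (1 <= i <= p)%N -> homog (p + q - 1) (a + b) (sub_comp i x y).
Proof.
move=> hx hy ip; rewrite /homog/= /sub_homog (val_sub_comp _ hx)//.
exact: comp_homog.
Qed.

Fact sub_comp_linearl i y (c : k) (x x' : sub_gseq) :
  sub_comp i (c *: x + x') y = c *: sub_comp i x y + sub_comp i x' y.
Proof. by apply: val_inj; rewrite /= trunc_lin comp_linearl. Qed.

Fact sub_comp_linearr i x (c : k) (y y' : sub_gseq) :
  sub_comp i x (c *: y + y') = c *: sub_comp i x y + sub_comp i x y'.
Proof. by apply: val_inj; rewrite /= comp_linearr. Qed.

Fact sub_comp_assoc p a q b r c i j (x y z : sub_gseq) :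
  homog p a x -> homog q b y -> homog r c z ->
  (1 <= i <= p)%N -> (1 <= j <= q)%N ->
  sub_comp i x (sub_comp j y z) = sub_comp (i + j - 1) (sub_comp i x y) z.
Proof.
move=> hx hy hz ip jq; apply: val_inj.
rewrite (val_sub_comp _ hx)// (val_sub_comp _ hy)//.
rewrite (val_sub_comp _ (sub_comp_homog hx hy ip)); last lia.
by rewrite (val_sub_comp _ hx)//; apply: comp_assoc hx hy hz ip jq.
Qed.

Fact sub_comp_comm p a q b r c i j (x y z : sub_gseq) :
  homog p a x -> homog q b y -> homog r c z ->
  (1 <= j)%N -> (j < i)%N -> (i <= p)%N ->
  sub_comp j (sub_comp i x y) z =
    ksign (b * c) *: sub_comp (i + r - 1) (sub_comp j x z) y.
Proof.
move=> hx hy hz j1 ji ip; apply: val_inj.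
rewrite (val_sub_comp _ (sub_comp_homog hx hy _)); [|lia..].
rewrite (val_sub_comp _ hx); last lia.
rewrite [RHS](_ : _ =
  ksign (b * c) *: val (sub_comp (i + r - 1) (sub_comp j x z) y))//.
rewrite (val_sub_comp _ (sub_comp_homog hx hz _)); [|lia..].
rewrite (val_sub_comp _ hx); last lia.
exact: comp_comm hx hy hz j1 ji ip.
Qed.

Fact sub_comp_idl q b (y : sub_gseq) : homog q b y -> sub_comp 1 sub_id y = y.
Proof.
move=> hy; apply: val_inj.
rewrite (val_sub_comp _ (x := sub_id) (op_id_homog P))//.
exact: comp_idl hy.
Qed.

Fact sub_comp_idr p a i (x : sub_gseq) : homog p a x -> (1 <= i <= p)%N ->
  sub_comp i x sub_id = x.
Proof.
move=> hx ip; apply: val_inj; rewrite (val_sub_comp _ hx)//.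
exact: comp_idr hx ip.
Qed.

Definition suboperad : operad k :=
  @Operad k sub_gseq sub_comp sub_id (op_id_homog P) sub_comp_linearl
    sub_comp_linearr sub_comp_homog sub_comp_assoc sub_comp_comm sub_comp_idl
    sub_comp_idr.

(** The maps [jO] and [jV] corestrict to the suboperad cut out by [N], so the universal property
    gives [u] from P to it. Followed by the inclusion, [u] agrees with [id] on [jO] and [jV], hence
    everywhere by uniqueness, and every element lies in the suboperad. *)
Lemma coprod_ind (O : operad k) (V : gseq k) (jO : O -> P) (jV : V -> P) :
  is_coprod_free jO jV ->
  (forall n a x, homog n a x -> N n a (jO x)) ->
  (forall n a v, homog n a v -> N n a (jV v)) ->
  forall n a x, homog n a x -> N n a x.
Proof.
move=> [jOm jVg univ] NO NV n a x hx.
have [[jOl jOh] jO1 jOc] := jOm; have [jVl jVh] := jVg.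
have sO y : jO y \in sub_pred.
  move: y; apply: homog_ind.
  - by rewrite (lin0 jOl) rpred0.
  - by move=> y z hy hz; rewrite (linD jOl) rpredD.
  - move=> p b y hy; apply: (@sub_homog_in p b); last exact: NO.
    exact: graded0_homog hy.
have sV y : jV y \in sub_pred.
  move: y; apply: homog_ind.
  - by rewrite (lin0 jVl) rpred0.
  - by move=> y z hy hz; rewrite (linD jVl) rpredD.
  - move=> p b y hy; apply: (@sub_homog_in p b); last exact: NV.
    exact: graded0_homog hy.
pose f y : suboperad := mksub (sO y).
pose g y : suboperad := mksub (sV y).
have fm : operad_map f.
  split.
  - by split=> [c y z|m b y /jOh//]; apply: val_inj; rewrite /= jOl.
  - exact: val_inj.
  - move=> p b q c i y z hy hz ip; apply: val_inj.
    rewrite [RHS](@val_sub_comp p b)//=; first exact: jOc hy hz ip.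
    exact: graded0_homog hy.
have gm : graded_map 0 g.
  by split=> [c y z|m b y /jVh//]; apply: val_inj; rewrite /= jVl.
have [u [[um uO uV] _]] := univ _ f g fm gm.
have [v [_ vu]] := univ _ jO jV jOm jVg.
have E : (fun y => val (u y)) = id :> (P -> P).
  rewrite -(vu id); last by split=> //; exact: operad_map_id.
  apply/esym/vu; split=> [|y|y]; [|by rewrite uO|by rewrite uV].
  have [[ul uh] u1 uc] := um; split.
  - by split=> [c y z|m b y /uh//]; rewrite ul.
  - by rewrite u1.
  - move=> p b q c i y z hy hz ip; rewrite (uc p b q c)//.
    rewrite [LHS](@val_sub_comp p b)//.
    by have := uh _ _ _ hy; rewrite addr0.
have Ex : val (u x) = x := congr1 (fun h => h x) E.
by rewrite -Ex; apply: sub_homogN (valP _); rewrite Ex.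
Qed.

End Suboperad.

(** * Evaluation of trees *)

Lemma ksignD (k : pzRingType) (a b : int) :
  ksign (a + b) = ksign a * ksign b :> k.
Proof.
rewrite /ksign -exprD -signr_odd -[RHS]signr_odd; congr (_ ^+ nat_of_bool _).
lia.
Qed.

Lemma ksignMM (k : pzRingType) (a : int) : ksign a * ksign a = 1 :> k.
Proof. by rewrite -expr2 sqrr_sign. Qed.

Lemma ksign0 (k : pzRingType) : ksign 0 = 1 :> k.
Proof. by []. Qed.

Section TreeLists.
Variables (k : comPzRingType) (O V : gseq k).
Notation tree := (ltree O V).
Implicit Types (t c : tree) (ts : seq (option tree)) (l : int * (O + V)).

Fixpoint in_children (Q : tree -> Prop) ts : Prop :=
  match ts with
  | [::] => True
  | None :: ts' => in_children Q ts'
  | Some c :: ts' => Q c /\ in_children Q ts'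
  end.

Lemma ltree_nested_ind (Q : tree -> Prop) :
  (forall l ts, in_children Q ts -> Q (LNode l ts)) -> forall t, Q t.
Proof.
move=> H; fix IH 1 => -[l ts]; apply: H.
by elim: ts => [|[c|] ts IHts].
Qed.

Lemma in_children_cat Q ts1 ts2 :
  in_children Q (ts1 ++ ts2) <-> in_children Q ts1 /\ in_children Q ts2.
Proof. by elim: ts1 => [|[c|] ts1 IH] /=; tauto. Qed.

Definition nleavesL ts : nat :=
  sumn (map (fun o => if o is Some c then nleaves c else 1%N) ts).
Definition labelsL ts : seq (int * (O + V)) :=
  flatten (map (fun o => if o is Some c then labels c else [::]) ts).
Definition deg t : int := \sum_(l <- labels t) l.1.
Definition degL ts : int := \sum_(l <- labelsL ts) l.1.

Lemma nleavesL_cat ts1 ts2 :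
  nleavesL (ts1 ++ ts2) = (nleavesL ts1 + nleavesL ts2)%N.
Proof. by rewrite /nleavesL map_cat sumn_cat. Qed.

Lemma degL_cat ts1 ts2 : degL (ts1 ++ ts2) = degL ts1 + degL ts2.
Proof. by rewrite /degL /labelsL map_cat flatten_cat big_cat. Qed.

Lemma degE l ts : deg (LNode l ts) = l.1 + degL ts.
Proof. by rewrite /deg big_cons. Qed.

Lemma degL_some c ts : degL (Some c :: ts) = deg c + degL ts.
Proof. by rewrite /degL big_cat. Qed.

Lemma degL_none ts : degL (None :: ts) = degL ts.
Proof. by []. Qed.

Lemma nleavesL_nseq n : nleavesL (nseq n None) = n.
Proof. by elim: n => [|n IH] //; rewrite -[in RHS]IH. Qed.

Lemma degL_nseq n : degL (nseq n None) = 0.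
Proof. by elim: n => [|n] //; rewrite /degL big_nil. Qed.

Definition label_ok (b : bool) n l : Prop :=
  match l.2 with
  | inl x => b /\ homog n l.1 x
  | inr v => ~~ b /\ homog n l.1 v
  end.

Fixpoint admissibleL b ts : Prop :=
  match ts with
  | [::] => True
  | None :: ts' => b /\ admissibleL b ts'
  | Some c :: ts' => admissible (~~ b) c /\ admissibleL b ts'
  end.

Lemma admissibleE b l ts :
  admissible b (LNode l ts) <-> label_ok b (size ts) l /\ admissibleL b ts.
Proof.
rewrite /= -/(label_ok b (size ts) l); set F := (X in _ /\ X <-> _).
suff -> : F = admissibleL b ts by [].
by rewrite /F; elim: ts {F} => [|[c|] ts IH]//=; rewrite IH.
Qed.

Lemma admissibleL_cat b ts1 ts2 :
  admissibleL b (ts1 ++ ts2) <-> admissibleL b ts1 /\ admissibleL b ts2.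
Proof. by elim: ts1 => [|[c|] ts1 IH] /=; tauto. Qed.

Lemma admissibleL_nseq n : admissibleL true (nseq n None).
Proof. by elim: n => //= n IH; split. Qed.

Lemma leaf_split ts i : (1 <= i <= nleavesL ts)%N -> exists ts1 o ts2,
  ts = ts1 ++ o :: ts2 /\
  (nleavesL ts1 < i <= nleavesL ts1 + (if o is Some c then nleaves c else 1))%N.
Proof.
elim: ts i => [|o ts IH] i; first by rewrite /nleavesL /=; lia.
have -> : nleavesL (o :: ts) =
    ((if o is Some c then nleaves c else 1) + nleavesL ts)%N by [].
set n := (if o is Some c then nleaves c else 1%N) => hi.
have [il|il] := leqP i n.
  exists [::], o, ts; split; rewrite // -/n /nleavesL /= add0n il.
  by case/andP: hi => ->.
have [|ts1 [o' [ts2 [-> h]]]] := IH (i - n)%N; first lia.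
exists (o :: ts1), o', ts2; split=> //.
have -> : nleavesL (o :: ts1) = (n + nleavesL ts1)%N by [].
by move: h; case: o' => [c|]; lia.
Qed.

End TreeLists.

(* An operad without the axiom on parallel compositions, which fails for the
   triangular matrices below; trees are still evaluated in the path order. *)
Record preoperad (k : comPzRingType) := PreOperad {
  po_car :> lmodType k;
  po_homog : nat -> int -> po_car -> Prop;
  po_comp : nat -> po_car -> po_car -> po_car;
  po_linl : forall i y, lin (fun x => po_comp i x y);
  po_linr : forall i x, lin (po_comp i x);
  po_comp_homog : forall p a q b i x y, po_homog p a x -> po_homog q b y ->
    (1 <= i <= p)%N -> po_homog (p + q - 1) (a + b) (po_comp i x y);
  po_assoc : forall p a q b r c i j x y z,
    po_homog p a x -> po_homog q b y -> po_homog r c z ->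
    (1 <= i <= p)%N -> (1 <= j <= q)%N ->
    po_comp i x (po_comp j y z) = po_comp (i + j - 1) (po_comp i x y) z }.
Arguments po_homog {k _}.
Arguments po_comp {k _}.

Section Evaluation.
Variables (k : comPzRingType) (O V : gseq k) (T : preoperad k).
Variable lam : int * (O + V) -> T.
Notation tree := (ltree O V).
Implicit Types (t c : tree) (ts : seq (option tree)) (l : int * (O + V)).

(** The value of a label may depend on its degree; this leaves room for the sign on the diagonal of
    a triangular matrix. *)
Fixpoint ev t : T :=
  let: LNode l ts := t in
  (fix go (i : nat) (acc : T) ts : T :=
    match ts with
    | [::] => acc
    | None :: ts' => go i.+1 acc ts'
    | Some c :: ts' => go (i + nleaves c)%N (po_comp i acc (ev c)) ts'
    end) 1%N (lam l) ts.

Fixpoint evL (i : nat) (acc : T) ts : T :=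
  match ts with
  | [::] => acc
  | None :: ts' => evL i.+1 acc ts'
  | Some c :: ts' => evL (i + nleaves c)%N (po_comp i acc (ev c)) ts'
  end.

Lemma evE l ts : ev (LNode l ts) = evL 1 (lam l) ts.
Proof.
by rewrite /=; move: 1%N (lam l); elim: ts => [|[c|] ts IH] i acc //=.
Qed.

Lemma evL_cat i acc ts1 ts2 :
  evL i acc (ts1 ++ ts2) = evL (i + nleavesL ts1) (evL i acc ts1) ts2.
Proof.
elim: ts1 i acc => [|[c|] ts1 IH] i acc /=; first by rewrite addn0.
  by rewrite IH addnA.
by rewrite IH addSn -addnS.
Qed.

Lemma evL_nseq i acc n : evL i acc (nseq n None) = acc.
Proof. by elim: n i => [|n IH] i /=. Qed.

Lemma evL_lin i ts : lin (fun acc => evL i acc ts).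
Proof.
move=> c x y; elim: ts i x y => [|[t|] ts IH] i x y //=.
by rewrite po_linl IH.
Qed.

Hypothesis lam_homog : forall b n l, label_ok b n l -> po_homog n l.1 (lam l).

(** Each child uses up one input and gives back as many inputs as it has leaves, whence
    [p + nleavesL ts - size ts]. The bound on [i + size ts] says that all inputs to be filled
    exist. *)
Let ev_homogL b ts :
  in_children (fun c => forall b, admissible b c ->
    po_homog (nleaves c) (deg c) (ev c)) ts ->
  forall p a i acc, admissibleL b ts -> po_homog p a acc ->
  (1 <= i)%N -> (i + size ts <= p.+1)%N ->
  po_homog (p + nleavesL ts - size ts) (a + degL ts) (evL i acc ts).
Proof.
elim: ts => [|[c|] ts IH] /= H p a i acc.
- by move=> _ hacc _ _; rewrite /degL big_nil /nleavesL /= addn0 subn0 addr0.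
- move: H => [Hc /IH{}IH] [ac ats] hacc i1 isz.
  have hc := Hc _ ac.
  have := IH _ _ (i + nleaves c)%N _ ats (po_comp_homog hacc hc _).
  rewrite degL_some addrA.
  have -> : nleavesL (Some c :: ts) = (nleaves c + nleavesL ts)%N by [].
  have -> : (p + nleaves c - 1 + nleavesL ts - size ts =
    p + (nleaves c + nleavesL ts) - (size ts).+1)%N by lia.
  by apply; lia.
- move: H => /IH{}IH [ac ats] hacc i1 isz.
  have := IH _ _ i.+1 _ ats hacc; rewrite degL_none.
  have -> : nleavesL (None :: ts) = (nleavesL ts).+1%N by [].
  have -> : (p + (nleavesL ts).+1 - (size ts).+1 = p + nleavesL ts - size ts)%N.
    lia.
  by apply; lia.
Qed.

Lemma ev_homog b t : admissible b t -> po_homog (nleaves t) (deg t) (ev t).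
Proof.
elim/ltree_nested_ind: t b => l ts H b /admissibleE[hl hts].
rewrite evE degE.
have := ev_homogL H hts (lam_homog hl) (leqnn 1) (leqnn _).
by rewrite addKn.
Qed.

Lemma evL_homog b ts p a i acc : admissibleL b ts -> po_homog p a acc ->
  (1 <= i)%N -> (i + size ts <= p.+1)%N ->
  po_homog (p + nleavesL ts - size ts) (a + degL ts) (evL i acc ts).
Proof.
apply: ev_homogL; elim: ts => [|[c|] ts IH] //=; split=> //.
by move=> b' hc; exact: ev_homog hc.
Qed.

(** * Composing a tree with a fixed element *)

Section Locate.
Variables (r : nat) (e : int) (z : T).
Hypothesis hz : po_homog r e z.

(** The two halves of the parallel axiom in which one grafted element is [z]: it sits to the left of
    the other one in [parallelR] and to its right in [parallelL]. *)
Definition parallelR := forall p a q b i j x y,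
  po_homog p a x -> po_homog q b y -> (1 <= j)%N -> (j < i)%N -> (i <= p)%N ->
  po_comp j (po_comp i x y) z =
    ksign (b * e) *: po_comp (i + r - 1) (po_comp j x z) y.
Definition parallelL := forall p a q b i j x y,
  po_homog p a x -> po_homog q b y -> (1 <= j)%N -> (j < i)%N -> (i <= p)%N ->
  po_comp j (po_comp i x z) y =
    ksign (e * b) *: po_comp (i + q - 1) (po_comp j x y) z.

Lemma evL_comp_right b ts p a i j acc : parallelR -> admissibleL b ts ->
  po_homog p a acc -> (1 <= j)%N -> (j < i)%N -> (i + size ts <= p.+1)%N ->
  exists s : k,
  po_comp j (evL i acc ts) z = s *: evL (i + r - 1) (po_comp j acc z) ts.
Proof.
move=> par; elim: ts p a i acc => [|[c|] ts IH] p a i acc /=.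
- by move=> _ _ _ _ _; exists 1; rewrite scale1r.
- move=> [ac ats] hacc j1 ji isz; have hc := ev_homog ac.
  have ip : (1 <= i <= p)%N by lia.
  have [|||s ->] := IH _ _ (i + nleaves c)%N _ ats (po_comp_homog hacc hc ip);
    try lia.
  rewrite (par _ _ _ _ i j _ _ hacc hc); [|lia..].
  exists (s * ksign (deg c * e)).
  rewrite (linZ (evL_lin _ _)) scalerA; congr (_ *: evL _ _ _).
  by move: (nleaves c) => n; lia.
- move=> [_ ats] hacc j1 ji isz.
  have [|||s ->] := IH _ _ i.+1 _ ats hacc; try lia.
  by exists s; congr (_ *: evL _ _ _); lia.
Qed.

(** The input [j] lies to the right of the children, so grafting them moves it to
    [j + nleavesL ts - size ts]; grafting [z] first leaves their own positions unchanged. *)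
Lemma evL_comp_left b ts p a i j acc : parallelL -> admissibleL b ts ->
  po_homog p a acc -> (1 <= i)%N -> (i + size ts <= j)%N -> (j <= p)%N ->
  exists s : k,
  po_comp (j + nleavesL ts - size ts) (evL i acc ts) z =
    s *: evL i (po_comp j acc z) ts.
Proof.
move=> par; elim: ts p a i j acc => [|[c|] ts IH] p a i j acc /=.
- by move=> _ _ _ _ _; exists 1; rewrite scale1r addn0 subn0.
- move=> [ac ats] hacc i1 isz jp; have hc := ev_homog ac.
  have ip : (1 <= i <= p)%N by lia.
  have [|||s] := IH _ _ (i + nleaves c)%N (j + nleaves c - 1)%N _ ats
    (po_comp_homog hacc hc ip); try lia.
  have -> : nleavesL (Some c :: ts) = (nleaves c + nleavesL ts)%N by [].
  have -> : (j + nleaves c - 1 + nleavesL ts - size ts =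
    j + (nleaves c + nleavesL ts) - (size ts).+1)%N by lia.
  move=> ->; have E := par _ _ _ _ j i _ _ hacc hc.
  rewrite E; [|lia..].
  exists (s * ksign (e * deg c)).
  by rewrite (linZ (evL_lin _ _)) !scalerA -mulrA ksignMM mulr1.
- move=> [_ ats] hacc i1 isz jp.
  have [|||s] := IH _ _ i.+1 j _ ats hacc; try lia.
  have -> : nleavesL (None :: ts) = (nleavesL ts).+1%N by [].
  have -> : (j + (nleavesL ts).+1 - (size ts).+1 = j + nleavesL ts - size ts)%N.
    lia.
  by move=> ->; exists s.
Qed.

(** The scalar is a product of Koszul signs whose value never matters. What matters is that it is
    common to all entries when [T] consists of matrices. *)
Definition comp_tree b i t t' : Prop :=
  [/\ admissible b t', nleaves t' = (nleaves t + r - 1)%N, deg t' = deg t + e &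
      exists s : k, po_comp i (ev t) z = s *: ev t'].

(** [parallelR] moves [z] past the children to the right of the input [i], and associativity moves
    it into the child containing [i]. The recursion ends at a leaf, which admissibility allows only
    on a vertex of odd level; this case is [base]. *)
Lemma comp_tree_ex b t i : parallelR ->
  (forall l ts1 ts2, admissible true (LNode l (ts1 ++ None :: ts2)) ->
    exists t',
      comp_tree true (nleavesL ts1).+1 (LNode l (ts1 ++ None :: ts2)) t') ->
  admissible b t -> (1 <= i <= nleaves t)%N -> exists t', comp_tree b i t t'.
Proof.
move=> par base; elim/ltree_nested_ind: t b i => l ts H b i adm hi.
have [ts1 [o [ts2 [Ets ho]]]] := leaf_split hi.
move: H adm hi; rewrite {ts}Ets.
case: o ho => [c|] ho; last first.
  move=> _ adm _; have -> : i = (nleavesL ts1).+1 by lia.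
  case: b adm => adm; first exact: base adm.
  by have /admissibleE[_ /admissibleL_cat[_ []]] := adm.
move=> /in_children_cat[_ [Hc _]] /admissibleE[hl].
move=> /admissibleL_cat[ats1 [ac ats2]] hi.
have [|c' [ac' nc' dc' [s Es]]] := Hc (~~ b) (i - nleavesL ts1)%N ac.
  lia.
have hlam := lam_homog hl.
have szE : size (ts1 ++ Some c :: ts2) = (size ts1 + (size ts2).+1)%N.
  by rewrite size_cat.
set B := evL 1 (lam l) ts1.
have hB : po_homog _ _ B :=
  evL_homog ats1 hlam (leqnn 1) ltac:(rewrite szE; lia).
have hc := ev_homog ac.
set A := po_comp (nleavesL ts1).+1 B (ev c).
have ip : (1 <= (nleavesL ts1).+1 <=
  size (ts1 ++ Some c :: ts2) + nleavesL ts1 - size ts1)%N.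
  by rewrite szE; lia.
have hA : po_homog _ _ A := po_comp_homog hB hc ip.
have [|||s' Es'] := evL_comp_right (j := i) (i := (nleavesL ts1).+1 + nleaves c)
  par ats2 hA; [lia|lia|rewrite szE; lia|].
have nE o ts : nleavesL (ts1 ++ Some o :: ts) =
    (nleavesL ts1 + (nleaves o + nleavesL ts))%N by rewrite nleavesL_cat.
exists (LNode l (ts1 ++ Some c' :: ts2)); split.
- apply/admissibleE; split; first by move: hl; rewrite !size_cat.
  by apply/admissibleL_cat.
- rewrite /= -!/(nleavesL _) !nE nc'; lia.
- by rewrite !degE !degL_cat !degL_some dc' !addrA; ring.
exists (s' * s); rewrite !evE !evL_cat /= -/B add1n -/A Es'.
have -> : po_comp i A z = s *: po_comp (nleavesL ts1).+1 B (ev c').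
  rewrite -(linZ (po_linr _ _)) -Es.
  rewrite (po_assoc hB hc hz); [|rewrite szE; lia|lia].
  by congr (po_comp _ _ _); lia.
rewrite (linZ (evL_lin _ _)) scalerA; congr (_ *: evL _ _ _).
by rewrite nc'; move: (nleaves c) ho => n ho; lia.
Qed.

Lemma graft_tree c l ts1 ts2 : parallelR -> admissible false c ->
  r = nleaves c -> e = deg c -> z = ev c ->
  admissible true (LNode l (ts1 ++ None :: ts2)) ->
  exists t',
    comp_tree true (nleavesL ts1).+1 (LNode l (ts1 ++ None :: ts2)) t'.
Proof.
move=> par ac Er Ee Ez /admissibleE[hl /admissibleL_cat[ats1 [_ ats2]]].
have hlam := lam_homog hl.
have szE : size (ts1 ++ None :: ts2) = (size ts1 + (size ts2).+1)%N.
  by rewrite size_cat.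
have hB := evL_homog ats1 hlam (leqnn 1) ltac:(rewrite szE; lia).
exists (LNode l (ts1 ++ Some c :: ts2)); split.
- apply/admissibleE; split; first by move: hl; rewrite !size_cat.
  by apply/admissibleL_cat.
- rewrite /= -!/(nleavesL _) !nleavesL_cat Er /nleavesL /=; lia.
- by rewrite !degE !degL_cat degL_some degL_none Ee; ring.
have [|||s Es] := evL_comp_right
  (j := (nleavesL ts1).+1) (i := (nleavesL ts1).+2) par ats2 hB;
  [lia|lia|rewrite szE; lia|].
exists s; rewrite !evE !evL_cat /= add1n Es Ez.
by congr (_ *: evL _ _ _); lia.
Qed.

Lemma relabel_tree l l' ts1 ts2 : parallelR -> parallelL ->
  label_ok true (size ts1 + r + size ts2) l' -> l'.1 = l.1 + e ->
  po_comp (size ts1).+1 (lam l) z = lam l' ->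
  admissible true (LNode l (ts1 ++ None :: ts2)) ->
  exists t',
    comp_tree true (nleavesL ts1).+1 (LNode l (ts1 ++ None :: ts2)) t'.
Proof.
move=> parR parL hl' El' Ez /admissibleE[hl /admissibleL_cat[ats1 [_ ats2]]].
have hlam := lam_homog hl.
have szE : size (ts1 ++ None :: ts2) = (size ts1 + (size ts2).+1)%N.
  by rewrite size_cat.
have hB := evL_homog ats1 hlam (leqnn 1) ltac:(rewrite szE; lia).
exists (LNode l' (ts1 ++ nseq r None ++ ts2)); split.
- apply/admissibleE; split.
    by move: hl'; rewrite !size_cat size_nseq addnA.
  by do 2![apply/admissibleL_cat; split=> //]; exact: admissibleL_nseq.
- rewrite /= -!/(nleavesL _) !nleavesL_cat nleavesL_nseq.
  rewrite (_ : nleavesL (None :: ts2) = (nleavesL ts2).+1)//; lia.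
- by rewrite !degE !degL_cat degL_nseq degL_none El'; ring.
have [|||s Es] := evL_comp_right
  (j := (nleavesL ts1).+1) (i := (nleavesL ts1).+2) parR ats2 hB;
  [lia|lia|rewrite szE; lia|].
have [|||s' Es'] := evL_comp_left (i := 1) (j := (size ts1).+1) parL ats1 hlam;
  [lia|lia|rewrite szE; lia|].
exists (s * s'); rewrite !evE !evL_cat evL_nseq nleavesL_nseq /= add1n Es.
move: Es'; rewrite Ez; have -> : ((size ts1).+1 + nleavesL ts1 - size ts1 =
  (nleavesL ts1).+1)%N by lia.
move=> ->; rewrite (linZ (evL_lin _ _)) scalerA.
by congr (_ *: evL _ _ _); lia.
Qed.

End Locate.

End Evaluation.

Definition preoperad_of (k : comPzRingType) (P : operad k) : preoperad k :=
  @PreOperad k P homog comp (@comp_linl k P) (@comp_linr k P)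
    (@comp_homog k P) (@comp_assoc k P).

Section Corolla.
Variables (k : comPzRingType) (O : operad k) (V : gseq k) (T : preoperad k).
Variable lam : int * (O + V) -> T.

Definition id_tree : ltree O V := LNode (0, inl op_id) [:: None].

(** A vertex of even level cannot carry leaves, so identities are placed on all its inputs. *)
Definition corolla n (a : int) (v : V) : ltree O V :=
  LNode (a, inr v) (nseq n (Some id_tree)).

Lemma id_tree_admissible : admissible true id_tree.
Proof. by apply/admissibleE; split=> //; split=> //; exact: op_id_homog. Qed.

Lemma ev_id_tree : ev lam id_tree = lam (0, inl op_id).
Proof. by []. Qed.

Lemma corolla_admissible n a v :
  homog n a v -> admissible false (corolla n a v).
Proof.
move=> hv; apply/admissibleE; split; first by split; rewrite ?size_nseq.
by elim: n {hv} => //= n IH; split=> //; exact: id_tree_admissible.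
Qed.

Lemma corolla_nleaves n a v : nleaves (corolla n a v) = n.
Proof.
by rewrite /= -/(nleavesL _); elim: n => // n IH; rewrite -[in RHS]IH.
Qed.

Lemma corolla_deg n a v : deg (corolla n a v) = a.
Proof.
rewrite degE -[RHS]addr0; congr (_ + _); elim: n => [|n IH].
  by rewrite /degL big_nil.
by rewrite [nseq _ _]/= degL_some IH degE degL_none /degL big_nil.
Qed.

Hypothesis lam_homog : forall b n l, label_ok b n l -> po_homog n l.1 (lam l).
Hypothesis unitr : forall p a i x, po_homog p a x -> (1 <= i <= p)%N ->
  po_comp i x (lam (0, inl op_id)) = x.

Lemma corolla_ev n a v : homog n a v -> ev lam (corolla n a v) = lam (a, inr v).
Proof.
move=> hv; have hl := @lam_homog false n (a, inr v) (conj erefl hv).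
rewrite evE; suff H m i : (1 <= i)%N -> (i + m <= n.+1)%N ->
    evL lam i (lam (a, inr v)) (nseq m (Some id_tree)) = lam (a, inr v).
  exact: H.
elim: m i => [//|m IH] i i1 im.
rewrite [nseq _ _]/= [LHS]/= (unitr hl); last lia.
by rewrite addn1; apply: IH; lia.
Qed.

End Corolla.

(** * Trees span the coproduct *)

Section Spanning.
Variables (k : comPzRingType) (O : operad k) (V : gseq k) (P : operad k).
Variables (jO : O -> P) (jV : V -> P).
Hypothesis cop : is_coprod_free jO jV.

Definition label_val (l : int * (O + V)) : preoperad_of P :=
  match l.2 with inl x => jO x | inr v => jV v end.

Lemma tree_evalE t : tree_eval jO jV t = ev label_val t.
Proof.
elim/ltree_nested_ind: t => l ts H.
rewrite evE /= -/(label_val l); move: 1%N (label_val l).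
elim: ts H => [|[c|] ts IH] //= H i acc; last exact: IH.
by have [-> h] := H; exact: IH.
Qed.

Lemma label_val_homog b n l : label_ok b n l -> po_homog n l.1 (label_val l).
Proof.
have [[[_ hO] _ _] [_ hV] _] := cop.
case: l => a [x|v] [_ /= h]; rewrite /label_val /=.
  by have := hO _ _ _ h; rewrite addr0.
by have := hV _ _ _ h; rewrite addr0.
Qed.

Definition tree_span n a (x : P) : Prop := forall M : P -> Prop,
  M 0 -> (forall (c : k) y z, M y -> M z -> M (c *: y + z)) ->
  (forall t, admissible true t -> nleaves t = n -> deg t = a ->
    M (ev label_val t)) -> M x.

Lemma tree_span0 n a : tree_span n a 0.
Proof. by move=> M M0. Qed.

Lemma tree_spanP n a (c : k) y z :
  tree_span n a y -> tree_span n a z -> tree_span n a (c *: y + z).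
Proof.
by move=> hy hz M M0 MP MT; exact: MP (hy M M0 MP MT) (hz M M0 MP MT).
Qed.

Lemma tree_spanT t : admissible true t ->
  tree_span (nleaves t) (deg t) (ev label_val t).
Proof. by move=> at_ M M0 MP MT; exact: MT. Qed.

Lemma operad_parallelR r e (z : P) : homog r e z ->
  @parallelR k (preoperad_of P) r e z.
Proof.
move=> hz p a q b i j x y hx hy j1 ji ip.
exact: comp_comm hx hy hz j1 ji ip.
Qed.

Lemma operad_parallelL r e (z : P) : homog r e z ->
  @parallelL k (preoperad_of P) e z.
Proof.
move=> hz p a q b i j x y hx hy j1 ji ip.
exact: comp_comm hx hz hy j1 ji ip.
Qed.

(** This is the property fed to [coprod_ind]: unlike membership in the span, it passes to composites
    formally, by associativity. Applied to the identity tree it gives membership back. *)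
Definition right_stable r e (z : P) : Prop := forall t i,
  admissible true t -> (1 <= i <= nleaves t)%N ->
  tree_span (nleaves t + r - 1) (deg t + e) (comp i (ev label_val t) z).

Lemma comp_tree_span r e z i t t' :
  @comp_tree _ _ _ (preoperad_of P) label_val r e z true i t t' ->
  tree_span (nleaves t + r - 1) (deg t + e) (comp i (ev label_val t) z).
Proof.
move=> [at' nt' dt' [s]]; rewrite [po_comp _ _ _]/= => ->.
rewrite -[_ *: _]addr0 -nt' -dt'; apply: tree_spanP; last exact: tree_span0.
exact: tree_spanT.
Qed.

Lemma coprod_tree_span n a x : homog n a x -> tree_span n a x.
Proof.
have lh := label_val_homog.
have jO1 : jO op_id = op_id by case: cop => -[].
have jOh : graded_map 0 jO by case: cop => -[].
have jVh : graded_map 0 jV by case: cop.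
have unitr p b i y : @po_homog k (preoperad_of P) p b y -> (1 <= i <= p)%N ->
    @po_comp k (preoperad_of P) i y (label_val (0, inl op_id)) = y.
  by move=> hy ip; rewrite /label_val /= jO1; exact: comp_idr hy ip.
move=> hx; suff H : right_stable n a x.
  have := H _ _ (id_tree_admissible O V) (erefl : (1 <= 1 <= 1)%N).
  rewrite ev_id_tree /label_val /= jO1 (comp_idl hx) /deg /= big_seq1 add0r.
  by rewrite addKn.
move: n a x hx; apply: (coprod_ind _ _ _ _ cop).
- move=> r e t i at_ it; rewrite comp0r; exact: tree_span0.
- move=> r e c y z hy hz t i at_ it; rewrite comp_linearr.
  by apply: tree_spanP; [exact: hy|exact: hz].
- move=> t i at_ it; rewrite addnK addr0.
  have ht := ev_homog lh at_.
  by rewrite (comp_idr ht it); exact: tree_spanT.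
- move=> p a q b i x y hx hy Nx Ny ip t j at_ jt.
  have ht := ev_homog lh at_.
  rewrite (comp_assoc ht hx hy jt ip).
  apply: (Nx t j at_ jt (fun w => tree_span _ _ (comp (j + i - 1) w y))).
  + by rewrite comp0l; exact: tree_span0.
  + by move=> c u v hu hv; rewrite comp_linearl; exact: tree_spanP.
  + move=> t' at' nt' dt'; have := Ny t' (j + i - 1)%N at'.
    rewrite nt' dt' addrA.
    have -> : (nleaves t + p - 1 + q - 1 = nleaves t + (p + q - 1) - 1)%N.
      lia.
    by apply; lia.
- move=> n a x hx t i at_ it.
  have hz : @po_homog k (preoperad_of P) n a (jO x).
    exact: graded0_homog jOh hx.
  suff [t' ht'] : exists t',
      @comp_tree _ _ _ (preoperad_of P) label_val n a (jO x) true i t t'.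
    exact: comp_tree_span ht'.
  apply: comp_tree_ex => //; first exact: operad_parallelR.
  move=> -[d [y|v]] ts1 ts2 adm; last first.
    by have /admissibleE[[]] := adm.
  have /admissibleE[[_ hy] _] := adm.
  apply: (relabel_tree lh
    (l' := (d + a, inl (comp (size ts1).+1 y x)))) => //.
  + exact: operad_parallelR.
  + exact: (operad_parallelL hz).
  + split=> //=; move: hy; rewrite size_cat /= => hy.
    have := comp_homog (i := (size ts1).+1) hy hx.
    have -> : (size ts1 + (size ts2).+1 + n - 1 = size ts1 + n + size ts2)%N.
      lia.
    by apply; lia.
  + rewrite /label_val /=; case: cop => -[_ _ jOc] _ _.
    by rewrite (jOc _ _ _ _ _ _ _ hy hx)// size_cat /=; lia.
- move=> n a v hv t i at_ it.
  have hz : @po_homog k (preoperad_of P) n a (jV v).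
    exact: graded0_homog jVh hv.
  suff [t' ht'] : exists t',
      @comp_tree _ _ _ (preoperad_of P) label_val n a (jV v) true i t t'.
    exact: comp_tree_span ht'.
  apply: comp_tree_ex => //; first exact: operad_parallelR.
  move=> l ts1 ts2 adm.
  apply: (graft_tree lh (c := corolla O n a v)) => //.
  + exact: operad_parallelR.
  + exact: corolla_admissible.
  + by rewrite corolla_nleaves.
  + by rewrite corolla_deg.
  + by rewrite (corolla_ev lh unitr hv).
Qed.

Lemma coprod_lin_ind n a x (M : P -> Prop) : homog n a x ->
  M 0 -> (forall (c : k) y z, M y -> M z -> M (c *: y + z)) ->
  (forall t, admissible true t -> nleaves t = n -> deg t = a ->
    M (ev label_val t)) -> M x.
Proof. by move=> /coprod_tree_span; apply. Qed.

End Spanning.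

(** * Triangular matrices over an operad *)

(* The triangular matrices [[x, 0], [w, y]]: for f, g of degree 0 and an (f, g)-
   derivation h of degree 1 one takes x = f u, w = h u, y = (-1)^|u| g u. *)
Section Triangular.
Variables (k : comPzRingType) (P : operad k).

Let T : lmodType k := (P * P * P)%type.

Definition tri_homog n (a : int) (u : T) : Prop :=
  [/\ homog n a u.1.1, homog n a u.1.2 & homog n (a + 1) u.2].

Definition tri_comp i (u v : T) : T :=
  (comp i u.1.1 v.1.1, comp i u.1.2 v.1.2,
   comp i u.2 v.1.1 + comp i u.1.2 v.2).

Fact tri_linl i v : lin (fun u => tri_comp i u v).
Proof.
move=> c u u'; rewrite /tri_comp /= !comp_linearl.
by congr (_, _, _); rewrite /= scalerDr addrACA.
Qed.

Fact tri_linr i u : lin (tri_comp i u).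
Proof.
move=> c v v'; rewrite /tri_comp /= !comp_linearr.
by congr (_, _, _); rewrite /= scalerDr addrACA.
Qed.

Fact tri_comp_homog p a q b i u v : tri_homog p a u -> tri_homog q b v ->
  (1 <= i <= p)%N -> tri_homog (p + q - 1) (a + b) (tri_comp i u v).
Proof.
move=> [hu1 hu2 hu3] [hv1 hv2 hv3] ip; split; [exact: comp_homog..|].
apply: homogD; first by rewrite addrAC; exact: comp_homog.
by rewrite -addrA; exact: comp_homog.
Qed.

Fact tri_assoc p a q b r c i j u v w :
  tri_homog p a u -> tri_homog q b v -> tri_homog r c w ->
  (1 <= i <= p)%N -> (1 <= j <= q)%N ->
  tri_comp i u (tri_comp j v w) = tri_comp (i + j - 1) (tri_comp i u v) w.
Proof.
move=> [hu1 hu2 hu3] [hv1 hv2 hv3] [hw1 hw2 hw3] ip jq; congr (_, _, _) => /=.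
- exact: comp_assoc hu1 hv1 hw1 ip jq.
- exact: comp_assoc hu2 hv2 hw2 ip jq.
rewrite (linD (comp_linr _ _)) (linD (comp_linl _ _)).
rewrite (comp_assoc hu3 hv1 hw1)// (comp_assoc hu2 hv3 hw1)//.
by rewrite (comp_assoc hu2 hv2 hw3)// addrA.
Qed.

Definition triangular : preoperad k :=
  @PreOperad k T tri_homog tri_comp tri_linl tri_linr tri_comp_homog tri_assoc.

(** The matrix of an element fixed by f and g and killed by h. In a parallel composition of two
    general matrices, h of one factor meets f of the other in one order and g of it in the other
    order; here these agree up to sign, and the terms with h of [z] vanish. *)
Definition tri_scalar (e : int) (z : P) : triangular := (z, ksign e *: z, 0).

Lemma tri_scalar_homog r e z : homog r e z -> po_homog r e (tri_scalar e z).
Proof. by move=> hz; split=> //=; [exact: homogZ|exact: homog0]. Qed.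

Lemma tri_parallelR r e z : homog r e z -> parallelR r e (tri_scalar e z).
Proof.
move=> hz p a q b i j u v [hu1 hu2 hu3] [hv1 hv2 hv3] j1 ji ip.
congr (_, _, _) => /=.
- exact: comp_comm hu1 hv1 hz j1 ji ip.
- exact: comp_comm hu2 hv2 (homogZ _ hz) j1 ji ip.
rewrite !comp0r addr0 addr0 (linD (comp_linl _ _)) scalerDr.
rewrite (comp_comm hu3 hv1 hz)// (comp_comm hu2 hv3 hz)//; congr (_ + _).
(* Exchanging [v.2], of degree [b + 1], with [z] costs the sign of [(b + 1) * e]; the excess
   [ksign e] over the expected sign is the one on the diagonal of [tri_scalar]. *)
rewrite (linZ (comp_linr _ _)) (linZ (comp_linl _ _)) scalerA -ksignD.
by congr (ksign _ *: _); ring.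
Qed.

Lemma tri_parallelL r e z : homog r e z -> parallelL e (tri_scalar e z).
Proof.
move=> hz p a q b i j u v [hu1 hu2 hu3] [hv1 hv2 hv3] j1 ji ip.
congr (_, _, _) => /=.
- exact: comp_comm hu1 hz hv1 j1 ji ip.
- exact: comp_comm hu2 (homogZ _ hz) hv2 j1 ji ip.
rewrite !comp0r addr0 addr0 (linD (comp_linl _ _)) scalerDr.
rewrite (comp_comm hu3 hz hv1)//; congr (_ + _).
rewrite (linZ (comp_linr _ _)) (linZ (comp_linl _ _)).
rewrite (comp_comm hu2 hz hv3)// scalerA -ksignD.
congr (_ *: _); rewrite mulrDr mulr1 addrCA ksignD.
by rewrite ksignD ksignMM mulr1.
Qed.

End Triangular.

(** * Relabeled trees and the sum over the path order *)

Section MapLabels.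
Variables (k : comPzRingType) (O V : gseq k).
Notation tree := (ltree O V).
Notation label := (int * (O + V))%type.
Implicit Types (t c : tree) (ts : seq (option tree)) (l : label).
Implicit Types f : nat -> label -> label.

Fixpoint map_labelsL f m ts : seq (option tree) :=
  match ts with
  | [::] => [::]
  | None :: ts' => None :: map_labelsL f m ts'
  | Some c :: ts' =>
      Some (map_labels f m c) :: map_labelsL f (m + size (labels c))%N ts'
  end.

Lemma map_labelsE f m l ts :
  map_labels f m (LNode l ts) = LNode (f m l) (map_labelsL f m.+1 ts).
Proof.
rewrite /=; congr LNode; move: m.+1; elim: ts {m} => [|[c|] ts IH] m //=.
  by rewrite IH.
by rewrite IH.
Qed.

Lemma labelsL_some c ts : labelsL (Some c :: ts) = labels c ++ labelsL ts.
Proof. by []. Qed.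

Lemma nleaves_map_labels f m t : nleaves (map_labels f m t) = nleaves t.
Proof.
elim/ltree_nested_ind: t m => l ts H m; rewrite map_labelsE /=.
rewrite -!/(nleavesL _); move: m.+1.
elim: ts H => [|[c|] ts IH] /= H i //.
  by case: H => Hc /IH{}IH; rewrite /nleavesL /= Hc -!/(nleavesL _) IH.
by rewrite /nleavesL /= -!/(nleavesL _) IH.
Qed.

Let map_labelsL_ext_of f f' ts :
  in_children (fun c => forall m m',
    (forall j, (j < size (labels c))%N -> f (m + j)%N = f' (m' + j)%N) ->
    map_labels f m c = map_labels f' m' c) ts ->
  forall m m',
    (forall j, (j < size (labelsL ts))%N -> f (m + j)%N = f' (m' + j)%N) ->
    map_labelsL f m ts = map_labelsL f' m' ts.
Proof.
elim: ts => [|[c|] ts IH] //= H m m' E; last by rewrite (IH H m m' E).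
case: H => Hc /IH{}IH; rewrite labelsL_some size_cat in E.
rewrite (Hc m m') => [|j jc]; last by apply: E; lia.
rewrite (IH _ (m' + size (labels c))%N) => [//|j jc].
by rewrite -!addnA; apply: E; lia.
Qed.

Lemma map_labels_ext f f' m m' t :
  (forall j, (j < size (labels t))%N -> f (m + j)%N = f' (m' + j)%N) ->
  map_labels f m t = map_labels f' m' t.
Proof.
elim/ltree_nested_ind: t m m' => l ts H m m' E; rewrite !map_labelsE.
have := E 0%N (ltn0Sn _); rewrite !addn0 => ->; congr LNode.
by apply: map_labelsL_ext_of => // j jts; rewrite !addSnnS; exact: E.
Qed.

Lemma map_labelsL_ext f f' m m' ts :
  (forall j, (j < size (labelsL ts))%N -> f (m + j)%N = f' (m' + j)%N) ->
  map_labelsL f m ts = map_labelsL f' m' ts.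
Proof.
apply: map_labelsL_ext_of; elim: ts => [|[c|] ts IH] //=; split=> //.
by move=> *; exact: map_labels_ext.
Qed.

Lemma map_labels_idfun m t : map_labels (fun=> id) m t = t.
Proof.
elim/ltree_nested_ind: t m => l ts H m; rewrite map_labelsE; congr LNode.
move: m.+1; elim: ts H => [|[c|] ts IH] //= H i; last by rewrite IH.
by case: H => -> /IH ->.
Qed.

Lemma map_labelsL_id f m ts :
  (forall j, (j < size (labelsL ts))%N -> f (m + j)%N = id) ->
  map_labelsL f m ts = ts.
Proof.
move=> E; rewrite (@map_labelsL_ext _ (fun=> id) _ 0 _ E).
move: 0%N; elim: ts {E} => [|[c|] ts IH] //= i; rewrite IH//.
by rewrite map_labels_idfun.
Qed.

End MapLabels.

(* The path-order sum defining a tree homotopy is the lower left entry of the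
   evaluation of the tree in triangular matrices. *)
Section TriangularEvaluation.
Variables (k : comPzRingType) (O V : gseq k) (P : operad k).
Notation label := (int * (O + V))%type.
Variables (lam : label -> preoperad_of P) (g h : label -> label).
Implicit Types (t c : ltree O V) (ts : seq (option (ltree O V))) (l : label).

Definition tri_label l : triangular P :=
  (lam l, ksign l.1 *: lam (g l), lam (h l)).

Definition step m j : label -> label :=
  if (j < m)%N then g else if j == m then h else id.

Definition homotopy_sum t : P :=
  \sum_(m < size (labels t)) ksign (\sum_(l <- take m (labels t)) l.1) *:
    ev lam (map_labels (step m) 0 t).

Let tri_evL_of ts :
  in_children (fun c => ev tri_label c =
    (ev lam c, ksign (deg c) *: ev lam (map_labels (fun=> g) 0 c),
     homotopy_sum c)) ts ->
  forall i (u : triangular P), evL tri_label i u ts =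
    (evL lam i u.1.1 ts,
     ksign (degL ts) *: evL lam i u.1.2 (map_labelsL (fun=> g) 0 ts),
     evL lam i u.2 ts + \sum_(m < size (labelsL ts))
       ksign (\sum_(l <- take m (labelsL ts)) l.1) *:
       evL lam i u.1.2 (map_labelsL (step m) 0 ts)).
Proof.
elim: ts => [|[c|] ts IH] H i u /=.
- by rewrite /degL big_nil big_ord0 addr0 ksign0 scale1r; case: u => [[]].
- case: H => -> /IH{}IH; rewrite IH /= nleaves_map_labels.
  congr (_, _, _) => /=.
    rewrite degL_some (linZ (comp_linr _ _)) (linZ (evL_lin _ _ _)) scalerA.
    rewrite -ksignD [deg c + _]addrC; congr (_ *: _).
    apply: (f_equal (evL lam _ _)).
    exact: map_labelsL_ext.
  rewrite (linD (evL_lin _ _ _)) -addrA; congr (_ + _).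
  (* Either the homotopy hits a label of [c], and [ts] is unchanged, or it hits a label of [ts]
     after all of [c] has gone through [g]. *)
  rewrite labelsL_some size_cat big_split_ord /=; congr (_ + _).
    rewrite /homotopy_sum (lin_sum (comp_linr _ _)) (lin_sum (evL_lin _ _ _)).
    apply: eq_bigr => m _.
    rewrite (linZ (comp_linr _ _)) (linZ (evL_lin _ _ _)).
    rewrite takel_cat 1?ltnW//; congr (_ *: _); rewrite nleaves_map_labels.
    rewrite (map_labelsL_id (m := (0 + _)%N))// => j _.
    rewrite /step; case: ltnP => [|_]; first by have := ltn_ord m; lia.
    by case: eqP => //; have := ltn_ord m; lia.
  apply: eq_bigr => m _; rewrite nleaves_map_labels.
  rewrite take_cat ltnNge leq_addr /= addKn big_cat /= ksignD mulrC -scalerA.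
  rewrite (linZ (comp_linr _ _)) (linZ (evL_lin _ _ _)); congr (_ *: (_ *: _)).
  rewrite (@map_labels_ext _ _ _ _ (fun=> g) 0 0) => [|j jc]; last first.
    by rewrite /step !add0n ltn_addr.
  apply: (f_equal (evL lam _ _)); apply: map_labelsL_ext => j _.
  by rewrite /step !add0n ltn_add2l eqn_add2l.
- by rewrite IH// degL_none.
Qed.

(** An off-diagonal entry of a product of triangular matrices chooses one factor from which its
    off-diagonal entry is taken. The factors before it contribute [g] with a sign, those after it
    their first entry, and the nested composition lists the factors in the path order. *)
Lemma tri_ev t : ev tri_label t =
  (ev lam t, ksign (deg t) *: ev lam (map_labels (fun=> g) 0 t),
   homotopy_sum t).
Proof.
elim/ltree_nested_ind: t => l ts H.
have E : homotopy_sum (LNode l ts) = \sum_(m < (size (labelsL ts)).+1)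
    ksign (\sum_(l' <- take m (l :: labelsL ts)) l'.1) *:
    evL lam 1 (lam (step m 0 l)) (map_labelsL (step m) 1 ts).
  by apply: eq_bigr => m _; rewrite map_labelsE evE.
rewrite {}E evE tri_evL_of// map_labelsE !evE degE.
congr (_, _, _).
  rewrite [tri_label l]/= (linZ (evL_lin _ _ _)) scalerA -ksignD addrC.
  by congr (_ *: _); apply: (f_equal (evL lam _ _)); exact: map_labelsL_ext.
rewrite big_ord_recl take0 big_nil ksign0 scale1r; congr (_ + _).
  by rewrite map_labelsL_id.
apply: eq_bigr => m _.
rewrite lift0 [take _ _]/= big_cons ksignD mulrC -scalerA.
rewrite [tri_label l]/= (linZ (evL_lin _ _ _)); congr (_ *: (_ *: _)).
apply: (f_equal (evL lam _ _)); apply: map_labelsL_ext => j _.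
by rewrite /step !add1n !add0n ltnS eqSS.
Qed.

End TriangularEvaluation.

(** * Linearity of the homotopies *)

Section EvalLeft.
Variables (k : comPzRingType) (O V : gseq k) (T : preoperad k).
Variable lam : int * (O + V) -> T.
Hypothesis lam_homog : forall b n l, label_ok b n l -> po_homog n l.1 (lam l).

Lemma comp_evL b (ts : seq (option (ltree O V))) r e z p a i j acc :
  po_homog r e z -> admissibleL b ts -> po_homog p a acc ->
  (1 <= i <= r)%N -> (1 <= j)%N -> (j + size ts <= p.+1)%N ->
  po_comp i z (evL lam j acc ts) = evL lam (i + j - 1) (po_comp i z acc) ts.
Proof.
move=> hz; elim: ts p a j acc => [//|[c|] ts IH] p a j acc /=.
- move=> [ac ats] hacc ir j1 jsz; have hc := ev_homog lam_homog ac.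
  have jp : (1 <= j <= p)%N by lia.
  rewrite (IH _ _ _ _ ats (po_comp_homog hacc hc jp))//; [|lia..].
  rewrite (po_assoc hz hacc hc)//; apply: (f_equal (fun n => evL _ n _ _)).
  by move: (nleaves c) => n; lia.
- move=> [_ ats] hacc ir j1 jsz; rewrite (IH _ _ _ _ ats hacc)//; [|lia..].
  by apply: (f_equal (fun n => evL _ n _ _)); lia.
Qed.

End EvalLeft.

(** [ls_fix] also forces [h z = 0], because [h i0 = 0], so the matrix of such a z is a [tri_scalar].
    The sign in [ls_left] is the one in the module structure of a suspension. *)
Record lin_scalar (k : comPzRingType) (O : dgoperad k) (C : op_cylinder O)
    (r : nat) (e : int) (z : C) : Prop := LinScalar {
  ls_homog : homog r e z;
  ls_fix : oc_i0 C (oc_p C z) = z;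
  ls_right : forall p a i x, homog p a x -> (1 <= i <= p)%N ->
    oc_h C (comp i x z) = comp i (oc_h C x) z;
  ls_left : forall p a i x, homog p a x -> (1 <= i <= r)%N ->
    oc_h C (comp i z x) = ksign e *: comp i z (oc_h C x) }.

Section OpCylinder.
Variables (k : comPzRingType) (O : dgoperad k) (C : op_cylinder O).

Lemma oc_i0_op : operad_map (oc_i0 C). Proof. by case: (oc_i0_map C). Qed.
Lemma oc_i1_op : operad_map (oc_i1 C). Proof. by case: (oc_i1_map C). Qed.
Lemma oc_p_op : operad_map (oc_p C). Proof. by case: (oc_p_map C). Qed.

Lemma oc_i0_graded : graded_map 0 (oc_i0 C). Proof. by case: oc_i0_op. Qed.
Lemma oc_i1_graded : graded_map 0 (oc_i1 C). Proof. by case: oc_i1_op. Qed.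
Lemma oc_p_graded : graded_map 0 (oc_p C). Proof. by case: oc_p_op. Qed.
Lemma oc_h_graded : graded_map 1 (oc_h C).
Proof. exact: spc_h_graded (oc_spc C). Qed.

Lemma lin_scalar_h r e z : @lin_scalar k O C r e z -> oc_h C z = 0.
Proof. by case=> _ <- _ _; exact: (spc_hi0 (oc_spc C)). Qed.

Lemma lin_scalar_id : @lin_scalar k O C 1 0 op_id.
Proof.
have [_ p1 _] := oc_p_op; have [_ i1 _] := oc_i0_op; have [_ hh] := oc_h_graded.
split; first exact: op_id_homog.
- by rewrite p1 i1.
- move=> p a i x hx ip; rewrite (comp_idr hx ip).
  by rewrite (comp_idr (hh _ _ _ hx) ip).
- move=> p a i x hx ip; have -> : i = 1%N by lia.
  by rewrite (comp_idl hx) ksign0 scale1r (comp_idl (hh _ _ _ hx)).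
Qed.

End OpCylinder.

(** * The tree homotopy *)

Section TreeHomotopy.
Variables (k : comPzRingType) (O : dgoperad k) (P : op_cylinder O).
Variables (V : dgseq k) (Q : operad k) (jP : P -> Q) (jV : cyl V -> Q).
Hypothesis cop : is_coprod_free jP jV.
Variable h : Q -> Q.
Hypothesis hh : is_tree_homotopy jP jV h.

Let lam : int * (P + cyl V) -> preoperad_of Q := @label_val k P (cyl V) Q jP jV.
Let tri : int * (P + cyl V) -> triangular Q :=
  tri_label lam (@label_i0p k O P V) (@label_h k O P V).

Let jP_op : operad_map jP. Proof. by case: cop. Qed.
Let jP_graded : graded_map 0 jP. Proof. by case: jP_op. Qed.
Let jV_graded : graded_map 0 jV. Proof. by case: cop. Qed.

Let tri_homog b n l : label_ok b n l -> po_homog n l.1 (tri l).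
Proof.
case: l => a [y|w] [_ /= hl]; split; rewrite /lam /label_val /=.
- exact: graded0_homog jP_graded hl.
- apply/homogZ/(graded0_homog jP_graded)/(graded0_homog (oc_i0_graded P)).
  exact: graded0_homog (oc_p_graded P) hl.
- by apply: (graded0_homog jP_graded); have [_] := oc_h_graded P; apply.
- exact: graded0_homog jV_graded hl.
- apply/homogZ/(graded0_homog jV_graded); case: hl => h1 _ h3.
  by split; [exact: homogD|exact: homog0|exact: homog0].
- apply: (graded0_homog jV_graded); case: hl => _ _ h3.
  by split; [exact: homog0|rewrite addrK|exact: homog0].
Qed.

Let h_tri t : admissible true t -> h (ev tri t).1.1 = (ev tri t).2.
Proof.
move=> at_; rewrite /tri tri_ev /= -tree_evalE; case: hh => _ /(_ t at_) ->.
by apply: eq_bigr => m _; rewrite tree_evalE.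
Qed.

Let h_lin : lin h. Proof. by case: hh => -[]. Qed.

Let tri_unit : tri (0, inl op_id) = (op_id, op_id, 0).
Proof.
have [_ j1 _] := jP_op; have [_ p1 _] := oc_p_op P; have [_ i1 _] := oc_i0_op P.
rewrite /tri /tri_label /lam /label_val /= (lin_scalar_h (lin_scalar_id P)).
by rewrite p1 i1 j1 ksign0 scale1r (lin0 (f := jP)) //; case: jP_graded.
Qed.

Let tri_unitr p a i x : po_homog p a x -> (1 <= i <= p)%N ->
  po_comp i x (tri (0, inl op_id)) = x.
Proof.
case: x => [[x y] w] [/= hx hy hw] ip; rewrite tri_unit /= /tri_comp /=.
by rewrite (comp_idr hx ip) (comp_idr hy ip) (comp_idr hw ip) comp0r addr0.
Qed.

Lemma tree_homotopyP y : h (jP y) = jP (oc_h P y).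
Proof.
have [jl _] := jP_graded; have [hl _] := oc_h_graded P.
move: y; apply: lin_ext.
- by move=> c x y; rewrite jl h_lin.
- by move=> c x y; rewrite hl jl.
move=> n a y hy; pose t : ltree P (cyl V) := LNode (a, inl y) (nseq n None).
have at_ : admissible true t.
  apply/admissibleE; split; last exact: admissibleL_nseq.
  by split; rewrite ?size_nseq.
by have := h_tri at_; rewrite evE evL_nseq.
Qed.

Lemma tree_homotopyV w : h (jV w) = jV (cyl_h w : cyl V).
Proof.
have [jl _] := jV_graded.
move: w; apply: lin_ext.
- by move=> c x y; rewrite jl h_lin.
- move=> c x y; rewrite -jl; congr jV; congr (_, _, _) => /=.
    by rewrite scaler0 addr0.
  by rewrite scaler0 addr0.
move=> n a w hw.
(* The bottom vertex has odd level and needs a label in P, so the corolla of [w] stands on an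
   identity. This adds no term, since h kills the identity and [i0 p] fixes it. *)
pose t : ltree P (cyl V) :=
  LNode (0, inl op_id) [:: Some (corolla P n a (w : cyl V))].
have at_ : admissible true t.
  apply/admissibleE; split; first by split=> //; exact: op_id_homog.
  by split=> //; exact: corolla_admissible.
have [h1 _ h3] := tri_homog (l := (a, inr w)) (b := false) (conj erefl hw).
have E : ev tri t = po_comp 1 (tri (0, inl op_id))
    (ev tri (corolla P n a (w : cyl V))) by rewrite evE.
have := h_tri at_; rewrite E (corolla_ev tri_homog tri_unitr hw).
rewrite tri_unit /= (comp_idl h1) comp0l add0r => ->.
exact: comp_idl h3.
Qed.

Section Scalar.
Variables (r : nat) (e : int) (z : P).
Hypothesis hz : lin_scalar r e z.

Let jz : homog r e (jP z).
Proof. exact: graded0_homog jP_graded (ls_homog hz). Qed.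

Let i0p_z : oc_i0 P (oc_p P z) = z. Proof. exact: ls_fix hz. Qed.

(** One matrix identity gives a tree [t'] and a scalar [s]: its first entry writes [x o z] as [s]
    times [t'], its off-diagonal entry writes [(h x) o z] as [s] times [h] of [t']. Linearity of [h]
    concludes. *)
Lemma tree_homotopy_right p a i x : homog p a x -> (1 <= i <= p)%N ->
  h (comp i x (jP z)) = comp i (h x) (jP z).
Proof.
have [_ _ jc] := jP_op; have [_ _ pc] := oc_p_op P; have [_ _ ic] := oc_i0_op P.
move=> hx; move: i; apply: (coprod_lin_ind cop hx (M := fun x => forall i,
  (1 <= i <= p)%N -> h (comp i x (jP z)) = comp i (h x) (jP z))).
- by move=> i _; rewrite comp0l (lin0 h_lin) comp0l.
- move=> c y w Ey Ew i ip; rewrite comp_linearl !h_lin comp_linearl Ey//.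
  by rewrite Ew.
move=> t at_ nt dt i ip.
have [||t' [at' nt' dt' [s Es]]] := @comp_tree_ex k P (cyl V) (triangular Q) tri
    tri_homog r e (tri_scalar e (jP z)) (tri_scalar_homog jz) true t i
    (tri_parallelR jz) _ at_; last 1 first.
- have E1 := congr1 (fun u : triangular Q => u.1.1) Es.
  have E2 := congr1 (fun u : triangular Q => u.2) Es.
  move: E1 E2; rewrite /= -(h_tri at_) -(h_tri at') /tri !tri_ev /= comp0r.
  by rewrite addr0; move=> -> ->; rewrite (linZ h_lin).
- move=> -[d [y|v]] ts1 ts2 adm; last by have /admissibleE[[]] := adm.
  have /admissibleE[[_ hy] _] := adm; move: hy; rewrite size_cat /= => hy.
  have jy : (1 <= (size ts1).+1 <= size ts1 + (size ts2).+1)%N by lia.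
  apply: (relabel_tree tri_homog
    (l' := (d + e, inl (comp (size ts1).+1 y z)))) => //.
  + exact: tri_parallelR.
  + exact: (tri_parallelL jz).
  + split=> //=; have := comp_homog hy (ls_homog hz) jy.
    by have -> : (size ts1 + (size ts2).+1 + r - 1 = size ts1 + r + size ts2)%N
      by lia.
  (* Entry by entry: [jP] preserves compositions, [i0 p] is an operad map fixing [z], and the
     homotopy of [P] is linear at [z]. *)
  congr (_, _, _) => /=; rewrite /lam /label_val /=.
  + by rewrite (jc _ _ _ _ _ _ _ hy (ls_homog hz)).
  + rewrite (linZ (comp_linr _ _)) (linZ (comp_linl _ _)) scalerA -ksignD addrC.
    rewrite (pc _ _ _ _ _ _ _ hy (ls_homog hz))//.
    have py := graded0_homog (oc_p_graded P) hy.
    have pz := graded0_homog (oc_p_graded P) (ls_homog hz).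
    rewrite (ic _ _ _ _ _ _ _ py pz)// i0p_z.
    have ipy := graded0_homog (oc_i0_graded P) py.
    by rewrite (jc _ _ _ _ _ _ _ ipy (ls_homog hz)).
  + rewrite comp0r addr0 (ls_right hz hy jy).
    have hhy : homog _ _ (oc_h P y) := (oc_h_graded P).2 _ _ _ hy.
    by rewrite (jc _ _ _ _ _ _ _ hhy (ls_homog hz)).
- by rewrite nt.
Qed.

(** Here [z] merges with the bottom label, so the new tree is written down directly: its extra
    [i.-1] and [r - i] leaves are the remaining inputs of [z]. The sign is the diagonal entry of
    [tri_scalar]. *)
Lemma tree_homotopy_left p a i x : homog p a x -> (1 <= i <= r)%N ->
  h (comp i (jP z) x) = ksign e *: comp i (jP z) (h x).
Proof.
have [_ _ jc] := jP_op; have [_ _ pc] := oc_p_op P; have [_ _ ic] := oc_i0_op P.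
move=> hx ir; apply: (coprod_lin_ind cop hx
  (M := fun x => h (comp i (jP z) x) = ksign e *: comp i (jP z) (h x))).
- by rewrite comp0r (lin0 h_lin) comp0r scaler0.
- move=> c y w Ey Ew; rewrite comp_linearr !h_lin comp_linearr Ey Ew.
  by rewrite scalerDr !scalerA mulrC.
move=> [[d [y|v]] ts] /admissibleE[[// _ hy] ats] _ _; rewrite /= in hy.
pose t' : ltree P (cyl V) := LNode (e + d, inl (comp i z y))
  (nseq i.-1 None ++ ts ++ nseq (r - i) None).
have at' : admissible true t'.
  apply/admissibleE; split.
    split=> //=; rewrite !size_cat !size_nseq.
    have := comp_homog (ls_homog hz) hy ir.
    by have -> : (r + size ts - 1 = i.-1 + (size ts + (r - i)))%N by lia.
  apply/admissibleL_cat; split; first exact: admissibleL_nseq.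
  by apply/admissibleL_cat; split=> //; exact: admissibleL_nseq.
have E : ev tri t' =
    po_comp i (tri_scalar e (jP z)) (ev tri (LNode (d, inl y) ts)).
  have hl : label_ok true (size ts) (d, inl y : P + cyl V) by split.
  rewrite !evE (comp_evL tri_homog (tri_scalar_homog jz) ats (tri_homog hl))//.
  rewrite !evL_cat !evL_nseq nleavesL_nseq.
  have -> : (1 + i.-1 = i + 1 - 1)%N by lia.
  apply: (f_equal (fun u => evL tri _ u ts)).
  congr (_, _, _) => /=; rewrite /lam /label_val /=.
  + by rewrite (jc _ _ _ _ _ _ _ (ls_homog hz) hy).
  + rewrite (linZ (comp_linr _ _)) (linZ (comp_linl _ _)) scalerA -ksignD addrC.
    rewrite (pc _ _ _ _ _ _ _ (ls_homog hz) hy)//.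
    have py := graded0_homog (oc_p_graded P) hy.
    have pz := graded0_homog (oc_p_graded P) (ls_homog hz).
    rewrite (ic _ _ _ _ _ _ _ pz py)// i0p_z.
    have ipy := graded0_homog (oc_i0_graded P) py.
    by rewrite (jc _ _ _ _ _ _ _ (ls_homog hz) ipy).
  + rewrite comp0l add0r (ls_left hz hy ir).
    have hhy : homog _ _ (oc_h P y) := (oc_h_graded P).2 _ _ _ hy.
    rewrite (linZ (f := jP)); last by case: jP_graded.
    by rewrite (jc _ _ _ _ _ _ _ (ls_homog hz) hhy)// (linZ (comp_linl _ _)).
have at0 : admissible true (LNode (d, inl y : P + cyl V) ts).
  by apply/admissibleE; split=> //; split.
move: E at0; move: (LNode _ ts) => t E at0.
have := h_tri at'; rewrite E /= -(h_tri at0) comp0l add0r /tri !tri_ev /= => ->.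
by rewrite (linZ (comp_linl _ _)).
Qed.

End Scalar.

End TreeHomotopy.

(** * The perturbed homotopy of an induced cylinder *)

Section InducedLinear.
Variables (k : comPzRingType) (O O' : dgoperad k) (P : op_cylinder O).
Variables (V : dgseq k) (bd : V -> O) (jO : O -> O') (jV : V -> O').
Variables (P' : op_cylinder O') (jP : P -> P') (jIV : cyl V -> P').
Hypothesis ind : is_induced_cylinder bd jO jV jP jIV.
Hypothesis bd_lin : lin bd.

Let cop : is_coprod_free jP jIV.
Proof. exact: tc_coprod (ic_coprod ind). Qed.
Let jP_op : operad_map jP. Proof. by case: cop. Qed.
Let jP_graded : graded_map 0 jP. Proof. by case: jP_op. Qed.
Let jP_lin : lin jP. Proof. by case: jP_graded. Qed.

(** The bound [m.+1] guarantees that the term n = 0 is present. The first vanishing hypothesis kills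
    the term n = 1, the second all later ones. *)
Lemma oc_h_iter (h D : P' -> P') x m :
  oc_h P' x = \sum_(n < m.+1) iter n (fun z => h (D z)) (h x) ->
  h (D (h x)) = 0 -> h (D 0) = 0 -> oc_h P' x = h x.
Proof.
move=> -> E1 E2; rewrite big_ord_recl big1 ?addr0// => n _.
by rewrite lift0; elim: (nat_of_ord n) => // i IH; rewrite iterS IH.
Qed.

Lemma induced_hP y : oc_h P' (jP y) = jP (oc_h P y).
Proof.
have [h [D [hh [_ _ DO _] hE]]] := ic_h ind.
have [N hN] := hE (jP y); have E := hN N.+1 (leqnSn N).
have h0 : h 0 = 0 by case: hh => -[hl _] _; exact: lin0 hl.
have D0 : D 0 = 0 by rewrite -[X in D X](lin0 jP_lin) DO.
by rewrite (oc_h_iter E) ?(tree_homotopyP cop hh) ?DO ?D0 ?h0.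
Qed.

Lemma induced_hV (x : V) :
  oc_h P' (jIV (cyl_i1 x : cyl V)) = jIV (cyl_s x : cyl V).
Proof.
have [h [D [hh [_ _ DO DV] hE]]] := ic_h ind.
have [N hN] := hE (jIV (cyl_i1 x : cyl V)); have E := hN N.+1 (leqnSn N).
have h0 : h 0 = 0 by case: hh => -[hl _] _; exact: lin0 hl.
have D0 : D 0 = 0 by rewrite -[X in D X](lin0 jP_lin) DO.
have E1 : h (jIV (cyl_i1 x : cyl V)) = jIV (cyl_s x : cyl V).
  by rewrite (tree_homotopyV cop hh).
rewrite (oc_h_iter E) ?E1//; last by rewrite D0 h0.
rewrite DV (tree_homotopyP cop hh) /bd_cyl /= (lin0 bd_lin).
have [i0l _] := oc_i0_graded P; have [i1l _] := oc_i1_graded P.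
have [hl _] := oc_h_graded P.
rewrite (lin0 i0l) (lin0 i1l) add0r addr0 (linN hl) (spc_hh (oc_spc P)).
by rewrite oppr0 (lin0 jP_lin).
Qed.

Lemma induced_lin_scalar r e z :
  lin_scalar r e z -> lin_scalar (C := P') r e (jP z).
Proof.
move=> hz; have [h [D [hh [Dg Dleib DO _] hE]]] := ic_h ind.
have jz : homog r e (jP z) by exact: graded0_homog jP_graded (ls_homog hz).
have [[hl hg] _] := hh; have [Dl Dg'] := Dg.
(* [K] has degree 0, and in [KL] the sign from the Leibniz rule cancels the one from [h], so powers
   of [K] commute with composition by [jP z] without sign. *)
pose K x := h (D x).
have Kh p a x : homog p a x -> homog p a (K x).
  by move=> /Dg'/hg; rewrite subrK.
have KR p a i x : homog p a x -> (1 <= i <= p)%N ->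
    K (comp i x (jP z)) = comp i (K x) (jP z).
  move=> hx ip.
  rewrite /K (Dleib _ _ _ _ _ _ _ hx jz)// DO comp0r scaler0 addr0.
  by rewrite (tree_homotopy_right cop hh hz (Dg' _ _ _ hx)).
have KL p a i x : homog p a x -> (1 <= i <= r)%N ->
    K (comp i (jP z) x) = comp i (jP z) (K x).
  move=> hx ip; rewrite /K (Dleib _ _ _ _ _ _ _ jz hx)// DO comp0l add0r.
  rewrite (linZ hl) (tree_homotopy_left cop hh hz (Dg' _ _ _ hx))//.
  by rewrite scalerA ksignMM scale1r.
have iterh n p a x : homog p a x -> homog p a (iter n K x).
  by move=> hx; elim: n => //= n; exact: Kh.
split=> //.
- by rewrite (ic_pO ind) (ic_i0O ind) (ls_fix hz).
- move=> p a i x hx ip; have hhx := hg _ _ _ hx.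
  (* The two locally finite sums may stabilize at different bounds; both are cut at the maximum so
     as to be compared term by term. *)
  have [N1 /(_ (maxn N1 _) (leq_maxl _ _)) E1] := hE (comp i x (jP z)).
  have [N2 /(_ (maxn _ N2) (leq_maxr _ _)) E2] := hE x.
  rewrite (E1 N2) (E2 N1) (lin_sum (comp_linl _ _)); apply: eq_bigr => n _.
  rewrite (tree_homotopy_right cop hh hz hx)// -/K.
  elim: (nat_of_ord n) => //= m ->; exact: KR (iterh _ _ _ _ hhx) ip.
- move=> p a i x hx ip; have hhx := hg _ _ _ hx.
  have [N1 /(_ (maxn N1 _) (leq_maxl _ _)) E1] := hE (comp i (jP z) x).
  have [N2 /(_ (maxn _ N2) (leq_maxr _ _)) E2] := hE x.
  rewrite (E1 N2) (E2 N1) (lin_sum (comp_linr _ _)) scaler_sumr.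
  apply: eq_bigr => n _; rewrite (tree_homotopy_left cop hh hz hx)// -/K.
  elim: (nat_of_ord n) => //= m ->; rewrite {1}/K (linZ Dl) (linZ hl) -/(K _).
  by rewrite (KL _ _ _ _ (iterh _ _ _ _ hhx) ip).
Qed.

End InducedLinear.

(** * Transfinite induction over the stages *)

Section OrdinalInduction.
Variables (disp : Order.disp_t) (A : tbOrderType disp).
Hypothesis wfA : well_founded (fun b c : A => (b < c)%O).
Implicit Types b c d : A.

Lemma wf_minimum (S : A -> Prop) b : S b ->
  exists m, S m /\ forall d, S d -> (m <= d)%O.
Proof.
elim/(well_founded_ind wfA): b => b IH Sb.
have [[c [cb Sc]]|H] := pselect (exists c, (c < b)%O /\ S c).
  exact: IH Sc.
exists b; split=> // d Sd; rewrite leNgt; apply/negP => db; apply: H.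
by exists d.
Qed.

(** A least element above [b] exists by well-foundedness, so [xget] in [osucc] does not fall back on
    its default value. *)
Lemma osuccP b : (b < \top)%O ->
  (b < osucc b)%O /\ forall d, (b < d)%O -> (osucc b <= d)%O.
Proof.
move=> bt; have [m [bm hm]] := @wf_minimum (fun c => (b < c)%O) _ bt.
rewrite /osucc; case: xgetP => [c _ //|/(_ m)[]].
by split.
Qed.

Lemma ltxosucc (b : below_top A) c : (c < osucc (val b))%O = (c <= val b)%O.
Proof.
have [bs hb] := osuccP (valP b).
apply/idP/idP => [|cb]; last exact: le_lt_trans bs.
by apply: contraTT; rewrite -!(leNgt, ltNge) => /hb.
Qed.

(** Separates the generators attached at stage [b] from those already present there. *)
Lemma osucc_le (b c : below_top A) : (osucc (val c) <= osucc (val b))%O ->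
  c = b \/ (osucc (val c) <= val b)%O.
Proof.
move=> cb; have [//|bc] := leP (osucc (val c)) (val b); [by right|left].
apply/val_inj/eqP; rewrite eq_le -!ltxosucc bc andbT.
by apply: lt_le_trans cb; have [] := osuccP (valP c).
Qed.

Lemma ord_ind (Q : A -> Prop) : Q \bot%O ->
  (forall b : below_top A, Q (val b) -> Q (osucc (val b))) ->
  (forall b, is_limit b -> (forall c, (c < b)%O -> Q c) -> Q b) ->
  forall b, Q b.
Proof.
move=> Q0 QS QL b; elim/(well_founded_ind wfA): b => b IH.
have [->//|b0] := eqVneq b \bot%O.
have [[c [cb nc]]|H] := pselect (exists c, (c < b)%O /\ ~~ (osucc c < b)%O).
  have ct : (c < \top)%O by exact: lt_le_trans (lex1 b).
  have [_ /(_ b cb) cb'] := osuccP ct.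
  have -> : b = osucc c.
    by apply/eqP; rewrite eq_le cb' leNgt nc.
  exact: (QS (exist _ c ct)) (IH _ cb).
apply: QL => //; split; first by rewrite lt_def b0 le0x.
by move=> c cb; apply/negP => /negP nc; apply: H; exists c.
Qed.

End OrdinalInduction.

Lemma cpt_graded (k : comPzRingType) (X Z : gseq k) (f : X -> Z) j x :
  graded_map 0 f -> f (cpt j x) = cpt j (f x).
Proof.
move=> fg; have [fl _] := fg; have [s [us s0 E]] := cpt_sum x.
suff D : decomposes (f x) (fun i => f (cpt i x)).
  exact: (congr1 (fun h => h j) (decomposes_inj D (cptP (f x)))).
split; first by move=> i; apply: graded0_homog fg _; exact: cpt_homog.
exists s; split=> //; first by move=> i /s0 ->; exact: lin0 fl.
by rewrite {1}E (lin_sum fl).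
Qed.

(** * Directed systems and their colimits *)

Section SystemTheory.
Variables (k : comPzRingType) (disp : Order.disp_t) (A : tbOrderType disp).
Variables (P : A -> dgoperad k) (tr : forall b c, (b <= c)%O -> P b -> P c).
Hypothesis sys : is_system tr.

Lemma tr_op b c (bc : (b <= c)%O) : operad_map (@tr b c bc).
Proof. by case: sys => /(_ b c bc)[]. Qed.

Lemma tr_graded b c (bc : (b <= c)%O) : graded_map 0 (@tr b c bc).
Proof. by case: (tr_op bc). Qed.

Lemma tr_lin b c (bc : (b <= c)%O) : lin (@tr b c bc).
Proof. by case: (tr_graded bc). Qed.

Lemma tr_id b (bb : (b <= b)%O) x : tr bb x = x.
Proof. by case: sys. Qed.

Lemma tr_trans b c d (bc : (b <= c)%O) (cd : (c <= d)%O) (bd : (b <= d)%O) x :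
  tr cd (tr bc x) = tr bd x.
Proof. by case: sys => _ _ ->. Qed.

Section Colimit.
Variable b : A.
Hypothesis col : is_colim_at tr b.

Lemma colim_homog n a (x : P b) : homog n a x ->
  exists c (cb : (c < b)%O) (y : P c), homog n a y /\ tr (ltW cb) y = x.
Proof.
move=> hx; have [c [cb [y E]]] := col.1 x.
exists c, cb, (cpt (n, a) y); split; first exact: (cpt_homog (n, a)).
by rewrite (cpt_graded _ _ (tr_graded _)) E (cpt_id hx).
Qed.

Lemma colim_eq c d (cb : (c < b)%O) (db : (d < b)%O) (y : P c) (z : P d) :
  tr (ltW cb) y = tr (ltW db) z ->
  exists e (ce : (c <= e)%O) (de : (d <= e)%O) (eb : (e < b)%O),
    tr ce y = tr de z.
Proof.
move=> E; set m := Order.max c d.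
have cm : (c <= m)%O by rewrite le_max lexx.
have dm : (d <= m)%O by rewrite le_max lexx orbT.
have mb : (m < b)%O by rewrite gt_max cb.
have [|e [me [eb E0]]] := col.2 m mb (tr cm y - tr dm z).
  by rewrite (linB (@tr_lin _ _ _)) !(tr_trans _ _ (ltW _)) E subrr.
exists e, (le_trans cm me), (le_trans dm me), eb.
move: E0; rewrite (linB (@tr_lin _ _ _)) => /eqP; rewrite subr_eq0 => /eqP.
by rewrite !(tr_trans _ _ (le_trans _ me)).
Qed.

End Colimit.

End SystemTheory.

Section CanonicalCylinder.
Variables (k : comPzRingType) (disp : Order.disp_t) (A : tbOrderType disp).
Hypothesis wfA : well_founded (fun b c : A => (b < c)%O).
Variables (X : pseudo_cellular k A) (Y : canonical_cylinder X).

Let sX := pc_system X.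
Let sY := cc_system Y.

(** The data contain these compatibilities only from [b] to its successor and into limit stages. For
    the homotopy at a successor even this is not assumed but comes from [induced_hP], as the
    derivation vanishes on the previous stage. *)
Lemma cc_compat b c (bc : (b <= c)%O) :
  [/\ forall x, oc_i0 (Y c) (pc_tr X bc x) = cc_tr Y bc (oc_i0 (Y b) x),
      forall x, oc_i1 (Y c) (pc_tr X bc x) = cc_tr Y bc (oc_i1 (Y b) x),
      forall y, oc_p (Y c) (cc_tr Y bc y) = pc_tr X bc (oc_p (Y b) y) &
      forall y, oc_h (Y c) (cc_tr Y bc y) = cc_tr Y bc (oc_h (Y b) y)].
Proof.
have refl d (dd : (d <= d)%O) :
  [/\ forall x, oc_i0 (Y d) (pc_tr X dd x) = cc_tr Y dd (oc_i0 (Y d) x),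
      forall x, oc_i1 (Y d) (pc_tr X dd x) = cc_tr Y dd (oc_i1 (Y d) x),
      forall y, oc_p (Y d) (cc_tr Y dd y) = pc_tr X dd (oc_p (Y d) y) &
      forall y, oc_h (Y d) (cc_tr Y dd y) = cc_tr Y dd (oc_h (Y d) y)].
  by split=> x; rewrite (tr_id sX) (tr_id sY) || rewrite !(tr_id sY).
move: b bc; elim/(ord_ind wfA): c => [|c IH|c lc _] b bc.
- have E : b = \bot%O by apply/eqP; rewrite -lex0.
  by case: _ / (esym E) bc => bc; exact: refl.
- have [E|bc'] := eqVneq b (osucc (val c)).
    by case: _ / (esym E) bc => bc; exact: refl.
  have {}bc' : (b <= val c)%O by rewrite -(ltxosucc wfA) lt_neqAle bc'.
  have [H0 H1 Hp Hh] := IH _ bc'; have Hc := cc_succ Y c.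
  split=> x.
  + rewrite -(tr_trans sX bc' (le_osucc _) bc) (ic_i0O Hc) H0.
    by rewrite (tr_trans sY _ _ bc).
  + rewrite -(tr_trans sX bc' (le_osucc _) bc) (ic_i1O Hc) H1.
    by rewrite (tr_trans sY _ _ bc).
  + rewrite -(tr_trans sY bc' (le_osucc _) bc) (ic_pO Hc) Hp.
    by rewrite (tr_trans sX _ _ bc).
  + rewrite -(tr_trans sY bc' (le_osucc _) bc) (induced_hP Hc) Hh.
    by rewrite (tr_trans sY _ _ bc).
- have [E|bc'] := eqVneq b c.
    by case: _ / (esym E) bc => bc; exact: refl.
  have {}bc' : (b < c)%O by rewrite lt_neqAle bc'.
  have -> : bc = ltW bc' by exact: bool_irrelevance.
  exact: cc_limit_maps lc b bc'.
Qed.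

Definition stage_base b (z : X \bot%O) : Y b :=
  cc_tr Y (le0x b) (oc_i0 (Y \bot%O) z).

Lemma stage_base_op b : operad_map (stage_base b).
Proof. exact: operad_map_comp (oc_i0_op _) (tr_op sY _). Qed.

Lemma stage_base_tr b c (bc : (b <= c)%O) z :
  cc_tr Y bc (stage_base b z) = stage_base c z.
Proof. exact: (tr_trans sY). Qed.

Lemma stage_baseE b z : stage_base b z = oc_i0 (Y b) (pc_tr X (le0x b) z).
Proof. by have [->] := cc_compat (le0x b). Qed.

(** [cc_zero] is an equality of cylinders. Only pointwise identities are drawn from it, and [oc_i0]
    and [oc_p] serve as the identification of the two bottom operads, so that nothing is transported
    along it. *)
Lemma bottom_cylinder :
  [/\ forall x, oc_i1 (Y \bot%O) x = oc_i0 (Y \bot%O) x,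
      forall y, oc_i0 (Y \bot%O) (oc_p (Y \bot%O) y) = y &
      forall y, oc_h (Y \bot%O) y = 0].
Proof. by rewrite (cc_zero Y). Qed.

Lemma stage_base_lin_scalar b r e z : homog r e z ->
  lin_scalar (C := Y b) r e (stage_base b z).
Proof.
move=> hz.
have hb c : homog r e (stage_base c z).
  by case: (stage_base_op c) => h _ _; exact: graded0_homog h hz.
have fb c : oc_i0 (Y c) (oc_p (Y c) (stage_base c z)) = stage_base c z.
  by rewrite stage_baseE (spc_pi0 (oc_spc (Y c))).
elim/(ord_ind wfA): b => [|b IH|b lb IH].
- have [_ _ h0] := bottom_cylinder; split=> // p a i x hx ip.
    by rewrite !h0 comp0l.
  by rewrite !h0 comp0r scaler0.
- rewrite -(stage_base_tr (le_osucc (val b))).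
  have H := induced_lin_scalar (cc_succ Y b) IH.
  exact: H.
- split=> // p a i x hx ip;
    have [c [cb [y [hy <-]]]] := colim_homog sY (cc_limit Y lb) hx;
    have [_ _ trc] := tr_op sY (ltW cb); have [_ _ _ Hh] := cc_compat (ltW cb);
    rewrite -(stage_base_tr (ltW cb)) Hh.
    have hhy := (oc_h_graded (Y c)).2 _ _ _ hy.
    rewrite -(trc _ _ _ _ _ _ _ hy (hb c) ip) Hh (ls_right (IH c cb) hy ip).
    by rewrite (trc _ _ _ _ _ _ _ hhy (hb c) ip).
  have hhy := (oc_h_graded (Y c)).2 _ _ _ hy.
  rewrite -(trc _ _ _ _ _ _ _ (hb c) hy ip) Hh (ls_left (IH c cb) hy ip).
  rewrite (linZ (@tr_lin _ _ _ _ _ sY _ _ _)).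
  by rewrite (trc _ _ _ _ _ _ _ (hb c) hhy ip).
Qed.

(** * The universal property of the stages *)

Section UniversalProperty.
Variables (Q : operad k) (f : X \bot%O -> Q).
Variable g : forall b : below_top A, cyl (pc_V X b) -> Q.
Hypothesis f_op : operad_map f.
Hypothesis g_graded : forall b, graded_map 0 (@g b).

Definition extends b (u : Y b -> Q) : Prop :=
  [/\ operad_map u, forall z, u (stage_base b z) = f z &
      forall (c : below_top A) (cb : (osucc (val c) <= b)%O) w,
        u (cc_tr Y cb (cc_gen Y c w)) = g w].

Lemma extends_tr b c (bc : (b <= c)%O) (u : Y c -> Q) :
  extends u -> extends (fun y => u (cc_tr Y bc y)).
Proof.
move=> [uo uf ug]; split.
- exact: operad_map_comp (tr_op sY _) uo.
- by move=> z; rewrite stage_base_tr.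
- by move=> d db w; rewrite (tr_trans sY _ _ (le_trans db bc)).
Qed.

(** Uniqueness precedes existence, because it makes the extensions chosen at the stages below a
    limit compatible with each other. *)
Lemma extends_uniq b (u v : Y b -> Q) : extends u -> extends v ->
  forall y, u y = v y.
Proof.
elim/(ord_ind wfA): b u v => [|b IH|b lb IH] u v hu hv y.
- have [_ E _] := bottom_cylinder; rewrite -(tr_id sY (le0x _) y) -[y]E.
  by case: hu => _ -> _; case: hv => _ -> _.
- have [_ _ univ] := tc_coprod (ic_coprod (cc_succ Y b)).
  have [uo uf ug] := hu; have [vo vf vg] := hv.
  have hub := extends_tr (le_osucc (val b)) hu; have [uob _ _] := hub.
  have [w [_ W]] := univ Q _ (@g b) uob (g_graded b).
  have <- : w = u.
    by apply: W; split=> // x; rewrite -[RHS](ug b (lexx _)) (tr_id sY).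
  have <- // : w = v.
  apply: W; split=> // x; last by rewrite -[RHS](vg b (lexx _)) (tr_id sY).
  exact: IH (extends_tr (le_osucc (val b)) hv) hub x.
- have [c [cb [z <-]]] := (cc_limit Y lb).1 y.
  exact: IH cb _ _ (extends_tr (ltW cb) hu) (extends_tr (ltW cb) hv) z.
Qed.

Lemma extends_colim b : is_limit b ->
  (forall c, (c < b)%O -> exists u : Y c -> Q, extends u) ->
  exists u : Y b -> Q, extends u.
Proof.
move=> lb ex.
have col := cc_limit Y lb.
pose uu c (cb : (c < b)%O) := sval (cid (ex c cb)).
have uuP c (cb : (c < b)%O) : extends (uu c cb) by rewrite /uu; case: cid.
have uuE c d (cb : (c < b)%O) (db : (d < b)%O) (cd : (c <= d)%O) y :
    uu d db (cc_tr Y cd y) = uu c cb y.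
  exact: extends_uniq (extends_tr cd (uuP d db)) (uuP c cb) y.
have [u uE] : exists u : Y b -> Q, forall c (cb : (c < b)%O) y,
    u (cc_tr Y (ltW cb) y) = uu c cb y.
  (* The value does not depend on the representative: two representatives of [x] become equal at a
     stage [e] still below [b], where the chosen extensions agree with the previous ones. *)
  have H x : exists q, forall c (cb : (c < b)%O) y,
      cc_tr Y (ltW cb) y = x -> uu c cb y = q.
    have [c [cb [y E]]] := col.1 x; exists (uu c cb y) => d db z E'.
    have [e [ce [de [eb Ee]]]] := colim_eq sY col (etrans E (esym E')).
    by rewrite -(uuE _ _ cb eb ce) -(uuE _ _ db eb de) Ee.
  by exists (fun x => sval (cid (H x))) => c cb y; case: cid => q /= ->.
have common x x' : exists c (cb : (c < b)%O) y y',
    x = cc_tr Y (ltW cb) y /\ x' = cc_tr Y (ltW cb) y'.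
  have [c [cb [y <-]]] := col.1 x; have [d [db [y' <-]]] := col.1 x'.
  set m := Order.max c d.
  have cm : (c <= m)%O by rewrite le_max lexx.
  have dm : (d <= m)%O by rewrite le_max lexx orbT.
  have mb : (m < b)%O by rewrite gt_max cb.
  exists m, mb, (cc_tr Y cm y), (cc_tr Y dm y').
  by rewrite !(tr_trans sY _ _ (ltW _)).
have ul : lin u.
  move=> c x x'; have [d [db [y [y' [-> ->]]]]] := common x x'.
  rewrite -(tr_lin sY) !uE.
  by case: (uuP d db) => -[[l _] _ _] _ _; rewrite l.
exists u; split.
- split.
  + split=> // n a x hx; rewrite addr0.
    have [c [cb [y [hy <-]]]] := colim_homog sY col hx; rewrite uE.
    by case: (uuP c cb) => -[h _ _] _ _; exact: graded0_homog h hy.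
  + have [b0 _] := lb; have [_ t1 _] := tr_op sY (ltW b0).
    by rewrite -t1 uE; case: (uuP _ b0) => -[].
  + move=> p a q e i x x' hx hx' ip.
    have [c [cb [y [hy <-]]]] := colim_homog sY col hx.
    have [d [db [y' [hy' <-]]]] := colim_homog sY col hx'.
    set m := Order.max c d.
    have cm : (c <= m)%O by rewrite le_max lexx.
    have dm : (d <= m)%O by rewrite le_max lexx orbT.
    have mb : (m < b)%O by rewrite gt_max cb.
    rewrite -(tr_trans sY cm (ltW mb)) -(tr_trans sY dm (ltW mb)).
    have hz := graded0_homog (tr_graded sY cm) hy.
    have hz' := graded0_homog (tr_graded sY dm) hy'.
    have [_ _ tc] := tr_op sY (ltW mb).
    rewrite -(tc _ _ _ _ _ _ _ hz hz' ip) !uE.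
    by case: (uuP _ mb) => -[_ _ uc] _ _; exact: uc hz hz' ip.
- move=> z; have [b0 _] := lb.
  by rewrite -(stage_base_tr (ltW b0)) uE; case: (uuP _ b0).
(* No generator is attached at a limit stage: those visible there already live at a strictly smaller
   one. *)
- move=> c cb w; have cb' : (osucc (val c) < b)%O.
    have [_ ->//] := lb; apply: lt_le_trans cb.
    by have [] := osuccP wfA (valP c).
  have -> : cb = ltW cb' by exact: bool_irrelevance.
  rewrite uE; case: (uuP _ cb') => _ _ /(_ c (lexx _) w).
  by rewrite (tr_id sY).
Qed.

Lemma extends_ex b : exists u : Y b -> Q, extends u.
Proof.
elim/(ord_ind wfA): b => [|b [u hu]|b lb IH]; last exact: extends_colim.
(* At the bottom [oc_p] inverts [oc_i0], and there are no generators, since a successor is never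
   below [\bot]. *)
- exists (fun y => f (oc_p (Y \bot%O) y)); split.
  + exact: operad_map_comp (oc_p_op _) f_op.
  + move=> z; rewrite /stage_base (tr_id sY).
    by rewrite (spc_pi0 (oc_spc (Y \bot%O))).
  + move=> c cb; have [+ _] := osuccP wfA (valP c).
    by move=> /lt_le_trans/(_ cb); rewrite ltx0.
have [_ _ univ] := tc_coprod (ic_coprod (cc_succ Y b)).
have [uo uf ug] := hu.
have [v [[vo vu vg] _]] := univ Q u (@g b) uo (g_graded b).
exists v; split=> //.
- by move=> z; rewrite -(stage_base_tr (le_osucc (val b))) vu.
- move=> c cb w; have [E|cb'] := osucc_le wfA cb.
    by case: _ / (esym E) cb w => cb w; rewrite (tr_id sY).
  by rewrite -(tr_trans sY cb' (le_osucc (val b))) vu.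
Qed.

End UniversalProperty.

End CanonicalCylinder.

(** * The generators *)

Section DirectSumTheory.
Variables (k : comPzRingType) (I : choiceType) (V : I -> gseq k).

Lemma dsum_support (x : dsum V) : exists r, uniq r /\
  forall i, i \notin r -> x i = 0.
Proof.
have [r0 Er] := (@finite_seqP _ _).1 (dsum_fin x).
exists (undup r0); split; first exact: undup_uniq.
move=> i; rewrite mem_undup => /negP ir; apply/eqP/negP => /negP xi0; apply: ir.
by have : [set i | x i != 0]%classic i by []; rewrite Er.
Qed.

Lemma dsum_sum_inj (x : dsum V) r :
  uniq r -> (forall i, i \notin r -> x i = 0) ->
  x = \sum_(i <- r) (dsum_inj (x i) : dsum V).
Proof.
move=> ur x0; apply: dsum_ext => i; rewrite dsum_sumE.
have [ir|ir] := boolP (i \in r).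
  rewrite (bigD1_seq i) //= dfwith_in big1 ?addr0// => j ji.
  by rewrite /= dfwith_out.
rewrite x0// big_seq big1// => j jr; rewrite /= dfwith_out//.
by apply: contraNneq ir => <-.
Qed.

Lemma dsum_inj_lin i : lin (@dsum_inj k I V i : V i -> dsum V).
Proof.
move=> c x y; apply: dsum_ext => j /=.
have [ij|ij] := eqVneq i j.
  by case: j / ij; rewrite !dfwith_in.
by rewrite !dfwith_out// scaler0 addr0.
Qed.

Lemma dsum_inj_homog i n a (v : V i) :
  homog n a v -> homog n a (dsum_inj v : dsum V).
Proof. by move=> hv j /=; case: dfwithP => // l _; exact: homog0. Qed.

Definition cyl_inj i (w : cyl_gseq (V i)) : cyl_gseq (dsum V) :=
  (dsum_inj w.1.1, dsum_inj w.1.2, dsum_inj w.2).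

Lemma cyl_inj_graded i : graded_map 0 (@cyl_inj i).
Proof.
split; first by move=> c x y; rewrite /cyl_inj !dsum_inj_lin.
by move=> n a x [h1 h2 h3]; rewrite addr0; split; exact: dsum_inj_homog.
Qed.

Lemma cyl_component_graded i : graded_map 0 (fun u => @cyl_component k I V u i).
Proof.
split=> // n a x [h1 h2 h3]; rewrite addr0.
by split; [exact: h1|exact: h2|exact: h3].
Qed.

Lemma cyl_component_inj i j (w : cyl_gseq (V i)) : j != i ->
  cyl_component (cyl_inj w) j = 0.
Proof.
by rewrite eq_sym => ij; rewrite /cyl_component /= !dfwith_out.
Qed.

Lemma cyl_component_inj_id i (w : cyl_gseq (V i)) :
  cyl_component (cyl_inj w) i = w.
Proof. by rewrite /cyl_component /= !dfwith_in; case: w => [[]]. Qed.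

Lemma cyl_sumE (J : Type) (s : seq J) (F : J -> cyl_gseq (dsum V)) :
  \sum_(j <- s) F j =
    (\sum_(j <- s) (F j).1.1, \sum_(j <- s) (F j).1.2, \sum_(j <- s) (F j).2).
Proof.
elim: s => [|j s IH]; first by rewrite !big_nil.
by rewrite !big_cons IH; case: (F j) => [[]].
Qed.

Lemma cyl_dsum_support (u : cyl_gseq (dsum V)) : exists r, [/\ uniq r,
  forall i, i \notin r -> cyl_component u i = 0 &
  u = \sum_(i <- r) cyl_inj (cyl_component u i)].
Proof.
have [r1 [_ h1]] := dsum_support u.1.1; have [r2 [_ h2]] := dsum_support u.1.2.
have [r3 [_ h3]] := dsum_support u.2.
pose r := undup (r1 ++ r2 ++ r3).
have out i : i \notin r -> [/\ u.1.1 i = 0, u.1.2 i = 0 & u.2 i = 0].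
  rewrite mem_undup !mem_cat !negb_or => /and3P[i1 i2 i3].
  by split; [exact: h1|exact: h2|exact: h3].
have ur : uniq r by exact: undup_uniq.
exists r; split=> //.
  by move=> i /out[e1 e2 e3]; rewrite /cyl_component e1 e2 e3.
rewrite cyl_sumE /= -!dsum_sum_inj//; try by move=> i /out[].
by case: u {h1 h2 h3 out r ur} => [[]].
Qed.

End DirectSumTheory.

Section CylinderGenerators.
Variables (k : comPzRingType) (disp : Order.disp_t) (A : tbOrderType disp).
Hypothesis wfA : well_founded (fun b c : A => (b < c)%O).
Variables (X : pseudo_cellular k A) (Y : canonical_cylinder X).

Let sX := pc_system X.
Let sY := cc_system Y.

Definition stage_gen (b : below_top A) (w : cyl (pc_V X b)) : Y \top%O :=
  cc_tr Y (lex1 _) (cc_gen Y b w).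

Lemma cc_gen_graded b : graded_map 0 (@cc_gen _ _ _ _ Y b).
Proof. by case: (tc_coprod (ic_coprod (cc_succ Y b))). Qed.

Lemma pc_gen_graded b : graded_map 0 (@pc_gen _ _ _ X b).
Proof. by case: (tc_coprod (pc_succ X b)). Qed.

Lemma stage_gen_graded b : graded_map 0 (@stage_gen b).
Proof.
by have := graded_comp (cc_gen_graded b) (tr_graded sY (lex1 _)); rewrite addr0.
Qed.

Lemma stage_gen_lin b : lin (@stage_gen b).
Proof. by case: (stage_gen_graded b). Qed.

Lemma cyl_gens_inclE (u : cyl_gseq (gens X)) r : uniq r ->
  (forall b, b \notin r -> cyl_component u b = 0) ->
  cyl_gens_incl Y u =
    \sum_(b <- r) stage_gen (cyl_component u b : cyl (pc_V X b)).
Proof.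
move=> ur u0; apply: lin_fsum => // b /u0 E.
by apply: etrans (lin0 (@stage_gen_lin b)); rewrite /stage_gen E.
Qed.

Lemma cyl_gens_incl_lin : lin (cyl_gens_incl Y).
Proof.
move=> c u v.
have [r [ur u0 _]] := cyl_dsum_support u.
have [s [us v0 _]] := cyl_dsum_support v.
have uu := undup_uniq (r ++ s).
have out b : b \notin undup (r ++ s) ->
    cyl_component u b = 0 /\ cyl_component v b = 0.
  by rewrite mem_undup mem_cat negb_or => /andP[/u0 -> /v0 ->].
have cl b : cyl_component (c *: u + v) b =
    c *: cyl_component u b + cyl_component v b by [].
rewrite !(cyl_gens_inclE uu) => [|b /out[]|b /out[]|b /out[eu ev]]//.
  rewrite scaler_sumr -big_split; apply: eq_bigr => b _ /=.
  by rewrite cl stage_gen_lin.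
by rewrite cl eu ev scaler0 addr0.
Qed.

Lemma cyl_gens_incl_graded : graded_map 0 (cyl_gens_incl Y).
Proof.
split; first exact: cyl_gens_incl_lin.
move=> n a u hu; rewrite addr0; have [r [ur u0 _]] := cyl_dsum_support u.
rewrite (cyl_gens_inclE ur u0); apply: homog_sum => b _.
apply: (graded0_homog (stage_gen_graded b)).
exact: (graded0_homog (@cyl_component_graded _ _ (fun b => pc_V X b) b) hu).
Qed.

Lemma cyl_gens_incl_inj b (w : cyl (pc_V X b)) :
  cyl_gens_incl Y (cyl_inj w : cyl_gseq (gens X)) = stage_gen w.
Proof.
rewrite (@cyl_gens_inclE _ [:: b])//.
  by rewrite big_seq1 cyl_component_inj_id.
by move=> c; rewrite inE => cb; exact: cyl_component_inj.
Qed.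

(** At the top stage all generators are present, and by finiteness of supports a map out of the
    cylinder of [gens] amounts to its restrictions along [cyl_inj]; the universal property is thus
    [extends] at [\top]. *)
Lemma cyl_coprod_free : is_coprod_free (cyl_base_incl Y) (cyl_gens_incl Y).
Proof.
have baseE : cyl_base_incl Y = stage_base Y \top%O by [].
split; [exact: stage_base_op|exact: cyl_gens_incl_graded|].
move=> Q f g fo [gl gh].
pose gg b (w : cyl (pc_V X b)) := g (cyl_inj w : cyl_gseq (gens X)).
have ggg b : graded_map 0 (@gg b).
  have := graded_comp (@cyl_inj_graded _ _ (fun b => pc_V X b) b) (conj gl gh).
  by rewrite addr0.
have [u hu] := extends_ex wfA Y fo ggg \top%O.
have extE v : [/\ operad_map v, forall x, v (cyl_base_incl Y x) = f x &
    forall x, v (cyl_gens_incl Y x) = g x] <-> extends f gg v.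
  split=> -[vo vf vg]; split=> //.
    move=> c cb w; have -> : cb = lex1 _ by exact: bool_irrelevance.
    by rewrite -/(stage_gen _) -cyl_gens_incl_inj vg.
  move=> w; have [r [ur w0 E]] := cyl_dsum_support w.
  have [[vl _] _ _] := vo.
  rewrite (cyl_gens_inclE ur w0) (lin_sum vl) [in RHS]E (lin_sum gl).
  by apply: eq_bigr => b _; exact: vg.
exists u; split; first exact/extE.
move=> v /extE hv; apply: functional_extensionality_dep => y.
exact: (extends_uniq wfA ggg hu hv).
Qed.

(** The reduction to a single stage shared by the formulas for [i0], [i1] and the suspension. *)
Lemma gens_incl_map (Z : lmodType k) (F : X \top%O -> Z)
    (G : forall b, pc_V X b -> Z) (x : gens X) r : lin F ->
  (forall b v, F (pc_tr X (lex1 _) (pc_gen X b v)) = G b v) ->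
  uniq r -> (forall b, b \notin r -> x b = 0) ->
  F (gens_incl x) = \sum_(b <- r) G b (x b).
Proof.
move=> Fl FG ur x0; rewrite /gens_incl /dsum_rec (@lin_fsum _ _ _ r)//.
  by rewrite (lin_sum Fl); apply: eq_bigr => b _; exact: FG.
move=> b /x0 ->; rewrite (lin0 (f := pc_gen X b)).
  exact: lin0 (tr_lin sX _).
by case: (pc_gen_graded b).
Qed.

Lemma cyl_gens_i0 x :
  oc_i0 (Y \top%O) (gens_incl x) = cyl_gens_incl Y (cyl_i0 x).
Proof.
have [r [ur x0]] := dsum_support x.
rewrite (@cyl_gens_inclE _ r)//; last first.
  by move=> b /x0; rewrite /cyl_component /= => ->.
apply: (@gens_incl_map _ _
  (fun b v => stage_gen (cyl_i0 v : cyl (pc_V X b)))) => //.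
  by case: (oc_i0_graded (Y \top%O)).
move=> b v; have [H _ _ _] := cc_compat wfA Y (lex1 (osucc (val b))).
by rewrite H (ic_i0V (cc_succ Y b)).
Qed.

Lemma cyl_gens_i1 x :
  oc_i1 (Y \top%O) (gens_incl x) = cyl_gens_incl Y (cyl_i1 x).
Proof.
have [r [ur x0]] := dsum_support x.
rewrite (@cyl_gens_inclE _ r)//; last first.
  by move=> b /x0; rewrite /cyl_component /= => ->.
apply: (@gens_incl_map _ _
  (fun b v => stage_gen (cyl_i1 v : cyl (pc_V X b)))) => //.
  by case: (oc_i1_graded (Y \top%O)).
move=> b v; have [_ H _ _] := cc_compat wfA Y (lex1 (osucc (val b))).
by rewrite H (ic_i1V (cc_succ Y b)).
Qed.

Definition suspension (x : X \top%O) : Y \top%O :=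
  oc_h (Y \top%O) (oc_i1 (Y \top%O) x).

Lemma suspension_graded : graded_map 1 suspension.
Proof.
have := graded_comp (oc_i1_graded (Y \top%O)) (oc_h_graded (Y \top%O)).
by rewrite add0r.
Qed.

Lemma suspension_gens x : suspension (gens_incl x) = cyl_gens_incl Y (cyl_s x).
Proof.
have [r [ur x0]] := dsum_support x.
rewrite (@cyl_gens_inclE _ r)//; last first.
  by move=> b /x0; rewrite /cyl_component /= => ->.
apply: (@gens_incl_map _ _
  (fun b v => stage_gen (cyl_s v : cyl (pc_V X b)))) => //.
  by case: suspension_graded.
move=> b v; have [_ H1 _ Hh] := cc_compat wfA Y (lex1 (osucc (val b))).
rewrite /suspension H1 Hh (ic_i1V (cc_succ Y b)) (induced_hV (cc_succ Y b))//.
by case: (tc_bd_graded (pc_succ X b)).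
Qed.

(** Both inclusions coincide at the bottom. Hence [i1] turns composition with O_0 into composition
    with the image of O_0 under [i0], for which linearity of the homotopy is known. *)
Lemma i1_base z : oc_i1 (Y \top%O) (base_incl z) = cyl_base_incl Y z.
Proof.
have [_ H _ _] := cc_compat wfA Y (le0x \top%O); rewrite /base_incl H.
by have [-> _ _] := bottom_cylinder Y.
Qed.

Lemma suspension_base z : suspension (base_incl z) = 0.
Proof.
have [_ H1 _ Hh] := cc_compat wfA Y (le0x \top%O).
rewrite /suspension /base_incl H1 Hh; have [_ _ ->] := bottom_cylinder Y.
exact: lin0 (tr_lin sY _).
Qed.

Lemma suspensionP : is_suspension suspension.
Proof.
have [sl sh] := suspension_graded; have [_ _ ic] := oc_i1_op (Y \top%O).
have base_homog q b y : homog q b y -> homog q b (base_incl y : X \top%O).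
  exact: graded0_homog (tr_graded sX _).
split=> //.
- exact: suspension_gens.
- by move=> n a x _; exact: sh.
- move=> p a q b i x y _ hx hy ip.
  have hix := graded0_homog (oc_i1_graded (Y \top%O)) hx.
  rewrite /suspension (ic _ _ _ _ _ _ _ hx (base_homog _ _ _ hy) ip) i1_base.
  exact: (ls_right (stage_base_lin_scalar wfA Y \top%O hy) hix ip).
- move=> p a q b i x y _ hx hy ip.
  have hix := graded0_homog (oc_i1_graded (Y \top%O)) hx.
  rewrite /suspension (ic _ _ _ _ _ _ _ (base_homog _ _ _ hy) hx ip) i1_base.
  exact: (ls_left (stage_base_lin_scalar wfA Y \top%O hy) hix ip).
Qed.

End CylinderGenerators.

Theorem proposition3p1 (k : comPzRingType) (disp : Order.disp_t)
    (A : tbOrderType disp) (wfA : well_founded (fun b c : A => (b < c)%O))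
    (X : pseudo_cellular k A)
    (d0 : gens X -> X \bot%O) (d1 : gens X -> X \top%O)
    (Xlin : linear_with d0 d1) (Y : canonical_cylinder X) :
  is_coprod_free (cyl_base_incl Y) (cyl_gens_incl Y) /\
  exists sigma : X \top%O -> Y \top%O,
    is_suspension sigma /\
    forall x : gens X,
      [/\ dgo_dif (cyl_gens_incl Y (cyl_i0 x)) =
            oc_i0 (Y \top%O) (dgo_dif (gens_incl x)),
          dgo_dif (cyl_gens_incl Y (cyl_i1 x)) =
            oc_i1 (Y \top%O) (dgo_dif (gens_incl x)) &
          dgo_dif (cyl_gens_incl Y (cyl_s x)) =
            cyl_gens_incl Y (cyl_i0 x) - cyl_gens_incl Y (cyl_i1 x)
            - sigma (d1 x)].
Proof.
split; first exact: cyl_coprod_free.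
exists (suspension Y); split; first exact: suspensionP.
move=> x; have [i0o i0d] := oc_i0_map (Y \top%O).
have [i1o i1d] := oc_i1_map (Y \top%O).
rewrite -(cyl_gens_i0 wfA) -(cyl_gens_i1 wfA) -(suspension_gens wfA).
split; [by rewrite i0d|by rewrite i1d|].
(* i0 p - 1 = d h + h d, applied to i1 x *)
have H : oc_i0 (Y \top%O) (oc_p (Y \top%O) (oc_i1 (Y \top%O) (gens_incl x))) -
    oc_i1 (Y \top%O) (gens_incl x) =
    dgo_dif (suspension Y (gens_incl x)) +
    oc_h (Y \top%O) (dgo_dif (oc_i1 (Y \top%O) (gens_incl x))).
  exact: (spc_homotopy (oc_spc (Y \top%O))).
have [sl _] := suspension_graded Y; have [dx _] := Xlin x.
move: H; rewrite (spc_pi1 (oc_spc (Y \top%O))) -i1d dx.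
rewrite -/(suspension Y (base_incl (d0 x) + d1 x)) (linD sl).
by rewrite (suspension_base wfA) add0r => ->; rewrite addrK.
Qed.
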